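(* Let $\Gamma_1$ and $\Gamma_2$ be finite subgroups of $\mathbb{S}^1$ with $\Gamma_2\subset\Gamma_1$, let $k\in\mathbb{Z}$, and consider the action $\Gamma_1\times\mathbb{S}^1\to\mathbb{S}^1$, $(\xi,\gamma)\mapsto\xi^k\gamma$. Let $\mathrm{T}=\overline{\mathbb{B}}^2\times\mathbb{S}^1$ be the solid torus, with $\Gamma_1$ (hence also $\Gamma_2$) acting by $\xi\cdot(z,\gamma)=(\xi z,\xi^k\gamma)$. For $i=1,2$ let $\zeta_i:\mathrm{T}/\Gamma_i\to\overline{\mathbb{B}}^2/\Gamma_i$ be the map induced by the first projection, and let $G:\mathrm{T}/\Gamma_2\to\mathrm{T}/\Gamma_1$ and $g:\overline{\mathbb{B}}^2/\Gamma_2\to\overline{\mathbb{B}}^2/\Gamma_1$ be the natural quotient maps, so that $\zeta_1\circ G=g\circ\zeta_2$. Let $s_i:\mathbb{S}^1\to\zeta_i^{-1}([1])$ be the fiber over $[1]\in\overline{\mathbb{B}}^2/\Gamma_i$ given by $s_i(z)=[1,z]$, and let $s_i':\mathbb{S}^1/\Gamma_i\to\zeta_i^{-1}([0])$ be the fiber over $[0]$ given by $s_i'([z])=[0,z]$ (here $\mathbb{S}^1/\Gamma_i$ is the quotient by the action $(\xi,\gamma)\mapsto\xi^k\gamma$). Let $\sigma_i$, $i=1,2$, be a continuous section of the $\mathbb{S}^1$-principal bundle $\zeta_i:(\mathbb{S}^1\times\mathbb{S}^1)/\Gamma_i\to\mathbb{S}^1/\Gamma_i$ (the restriction of $\zeta_i$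 over $\partial\overline{\mathbb{B}}^2/\Gamma_i=\mathbb{S}^1/\Gamma_i$), such that $G\circ\sigma_2=\sigma_1\circ g$ on $\mathbb{S}^1/\Gamma_2$. Then: (1) $\mathrm{T}/\Gamma_i$ is homeomorphic to $\mathrm{T}$, and any fiber of $\zeta_i$ is a generator of $H_1(\mathrm{T}/\Gamma_i,\mathbb{Q})$. (2) $s_i=\frac{n_i}{d_i}s_i'$ in $H_1(\mathrm{T}/\Gamma_i,\mathbb{Q})$, where $n_i=|\Gamma_i|$ and $d_i=\gcd(k,n_i)$. (3) For $q\in\mathbb{Q}$: $[\Gamma_1:\Gamma_2]\,\sigma_1=q\,s_1$ in $H_1(\mathrm{T}/\Gamma_1,\mathbb{Q})$ if, and only if, $\sigma_2=q\,s_2$ in $H_1(\mathrm{T}/\Gamma_2,\mathbb{Q})$.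
   Context: $\mathbb{S}^1$ is the group of unit complex numbers and $\overline{\mathbb{B}}^2\subset\mathbb{C}$ is the closed unit disc; finite subgroups of $\mathbb{S}^1$ act on $\overline{\mathbb{B}}^2$ and on its boundary $\mathbb{S}^1$ by multiplication, and $\overline{\mathbb{B}}^2/\Gamma_i$ and the base $\mathbb{S}^1/\Gamma_i$ are the quotients by this action. Closed curves parameterized by an oriented circle ($\mathbb{S}^1$ or a quotient $\mathbb{S}^1/\Gamma_i$, oriented so that the quotient map from $\mathbb{S}^1$ is orientation preserving) are identified with the homology classes they define: the image of the fundamental class of the circle. The fibers of $\zeta_i$ are such curves (parameterized once around). *)

(* Defs.v *)
From HB Require Import structures.
From mathcomp Require Import all_boot all_order all_algebra finmap.
From mathcomp Require Import freeg complex.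
From mathcomp Require Import all_classical all_reals all_analysis.

Set Implicit Arguments.
Unset Strict Implicit.
Unset Printing Implicit Defensive.

Import Order.TTheory GRing.Theory Num.Theory.
Import numFieldNormedType.Exports.

Local Open Scope classical_set_scope.
Local Open Scope ring_scope.
Local Open Scope quotient_scope.

Definition continuous_map {X Y : topologicalType} (f : X -> Y)
    (f_cts : continuous f) : continuousType X Y :=
  HB.pack f (isContinuous.Build X Y f f_cts).

Definition homeomorphic (X Y : topologicalType) : Prop :=
  exists (f : continuousType X Y) (g : continuousType Y X),
    cancel f g /\ cancel g f.

Lemma set_type_continuous (X Y : topologicalType) (A : set Y) (f : X -> A) :
  continuous (fun x => set_val (f x) : Y) -> continuous f.
Proof.
move=> /continuousP fc; apply/continuousP => _ [B oB <-].
exact: fc.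
Qed.

(* The homology  ker g / im f  of  U -f-> V -g-> W.  The relation g \o f = 0 is
   not needed to form the quotient of ker g by the f u that lie in ker g. *)
Section Homology.
Context (A : nzRingType) (U V W : lmodType A).
Context (f : {linear U -> V}) (g : {linear V -> W}).

Definition is_cycle : {pred V} := [pred v | g v == 0].

Fact is_cycle_submod : submod_closed is_cycle.
Proof.
split=> [|a x y]; rewrite !inE ?linear0//.
by rewrite linearP => /eqP-> /eqP->; rewrite scaler0 addr0.
Qed.
HB.instance Definition _ := GRing.isSubmodClosed.Build A V is_cycle
  is_cycle_submod.

Record cycle := Cycle { cycle_val :> V; cycle_valP : cycle_val \in is_cycle }.
HB.instance Definition _ := [isSub for cycle_val].
HB.instance Definition _ := [Choice of cycle by <:].
HB.instance Definition _ := [SubChoice_isSubLmodule of cycle by <:].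

Definition is_boundary : {pred cycle} :=
  [pred z | `[< exists u, f u = val z >]].

Fact is_boundary_zmod : zmod_closed is_boundary.
Proof.
split=> [|x y]; rewrite !inE.
  by exists 0; rewrite linear0.
move=> [u fu] [v fv]; exists (u - v).
by rewrite linearB fu fv.
Qed.
HB.instance Definition _ := GRing.isZmodClosed.Build cycle is_boundary
  is_boundary_zmod.

Definition homology := Quotient.quot is_boundary.
HB.instance Definition _ := GRing.Zmodule.on homology.

Definition homology_class (z : cycle) : homology :=
  \pi_(Quotient.quot is_boundary) z.

Lemma homology_classK (x : homology) : homology_class (repr x) = x.
Proof. exact: reprK. Qed.

Lemma homology_classP (y z : cycle) :
  reflect (exists u, f u = val y - val z)
          (homology_class y == homology_class z).
Proof.
rewrite /homology_class -Quotient.idealrBE.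
by apply: (iffP idP); rewrite inE.
Qed.

Lemma homology_classD : {morph homology_class : y z / y + z}.
Proof. by move=> y z; rewrite /homology_class raddfD. Qed.

Definition homology_scale (a : A) (x : homology) : homology :=
  homology_class (a *: repr x).

Lemma homology_class_scale a z :
  homology_class (a *: z) = homology_scale a (homology_class z).
Proof.
have /eqP/homology_classP[u fu] := homology_classK (homology_class z).
apply/esym/eqP/homology_classP; exists (a *: u).
by rewrite linearZ fu /= scalerBr.
Qed.

Fact homology_scaleA a b x :
  homology_scale a (homology_scale b x) = homology_scale (a * b) x.
Proof.
by rewrite -[x]homology_classK -!homology_class_scale scalerA.
Qed.
Fact homology_scale1 : left_id 1 homology_scale.
Proof. by move=> x; rewrite /homology_scale scale1r homology_classK. Qed.
Fact homology_scaleDr : right_distributive homology_scale +%R.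
Proof.
move=> a x y; rewrite -[x]homology_classK -[y]homology_classK.
by rewrite -homology_classD -!homology_class_scale scalerDr homology_classD.
Qed.
Fact homology_scaleDl x : {morph homology_scale^~ x : a b / a + b}.
Proof.
move=> a b; rewrite -[x]homology_classK.
by rewrite -!homology_class_scale scalerDl homology_classD.
Qed.
HB.instance Definition _ := GRing.Zmodule_isLmodule.Build A homology
  homology_scaleA homology_scale1 homology_scaleDr homology_scaleDl.

End Homology.

Section FreeModule.
Context (A : nzRingType) (K : choiceType) (M : lmodType A) (f : K -> M).

Fact fglift_zmod_morphism : zmod_morphism (fglift f).
Proof. exact: lift_is_additive. Qed.
HB.instance Definition _ := GRing.isZmodMorphism.Build _ _ (fglift f)
  fglift_zmod_morphism.

Fact fglift_scalable : scalable (fglift f).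
Proof.
move=> a D; rewrite {1}/GRing.scale/= /fgscale -{3}[D]freeg_sumE.
rewrite 2!(raddf_sum (fglift f)) scaler_sumr; apply: eq_bigr => x _.
by rewrite /= !liftU scalerA.
Qed.
HB.instance Definition _ := GRing.isScalable.Build A _ _ _ (fglift f)
  fglift_scalable.

End FreeModule.

Definition std_simplex (R : realType) (n : nat) : set 'rV[R]_n.+1 :=
  [set t | (forall i, 0 <= t 0 i) /\ \sum_i t 0 i = 1].
Arguments std_simplex : clear implicits.

Section SingularChains.
Context (R : realType).

(* The affine map onto the i-th face: it inserts a zero coordinate at i. *)
Definition face_row n (i : 'I_n.+2) (t : 'rV[R]_n.+1) : 'rV[R]_n.+2 :=
  \row_j if unlift i j is Some j' then t 0 j' else 0.

Fact face_row_std n (i : 'I_n.+2) (t : std_simplex R n) :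
  face_row i (set_val t) \in std_simplex R n.+1.
Proof.
have [t0 t1] : std_simplex R n (set_val t) by exact: set_valP.
apply/mem_set; split=> [j|].
  by rewrite mxE; case: unliftP.
rewrite (bigD1_ord i)//= mxE unlift_none add0r -t1.
by apply: eq_bigr => j _; rewrite mxE liftK.
Qed.

Definition coface n (i : 'I_n.+2) (t : std_simplex R n) : std_simplex R n.+1 :=
  exist _ (face_row i (set_val t)) (face_row_std i t).

Fact coface_continuous n (i : 'I_n.+2) : continuous (@coface n i).
Proof.
apply: set_type_continuous.
have -> : (fun x => set_val (coface i x)) =
    face_row i \o (@set_val _ (std_simplex R n)) by [].
move=> x; apply: continuous_comp; first exact: initial_continuous.
move: (set_val x) => {x} t.
have FT : Filter (nbhs t) := nbhs_filter t.
have FF := fmap_filter (face_row i) (nbhs_filter t).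
apply/cvg_mx_entourageP => B entB.
have tB : \forall s \near t, forall j,
    (face_row i t 0 j, face_row i s 0 j) \in B.
  apply: (@filter_forall _ _
    (fun j s => (face_row i t 0 j, face_row i s 0 j) \in B) (nbhs t)) => j.
  case: (unliftP i j) => [j' ->|->].
    have /cvg_entourageP/(_ _ entB) := @coord_continuous R _ _ 0 j' t.
    move=> tB; apply: (@filterS _ (nbhs t) FT _ _ _ tB) => s /=.
    by rewrite !mxE liftK inE.
  by apply: nearW => s; rewrite !mxE unlift_none inE; exact: entourage_refl.
by apply: filterS tB => s sB k j; rewrite ord1.
Qed.

Definition simplex (n : nat) (X : topologicalType) : choiceType :=
  continuousType (std_simplex R n) X.

Definition face (X : topologicalType) n (i : 'I_n.+2) (s : simplex n.+1 X) :
    simplex n X :=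
  s \o continuous_map (@coface_continuous n i).

Definition push_simplex (X Y : topologicalType) (f : continuousType X Y) n
    (s : simplex n X) : simplex n Y :=
  f \o s.

Definition chain (A : nzRingType) (n : nat) (X : topologicalType) :
    lmodType A :=
  {freeg (simplex n X) / A}.

Definition boundary (A : nzRingType) (X : topologicalType) n :
    {linear chain A n.+1 X -> chain A n X} :=
  fglift (fun s => \sum_(i < n.+2) (-1) ^+ i *: << face i s >>).

Definition push_chain (A : nzRingType) (X Y : topologicalType)
    (f : continuousType X Y) n : {linear chain A n X -> chain A n Y} :=
  fglift (fun s => << push_simplex f s >>).

Lemma push_simplex_face (X Y : topologicalType) (f : continuousType X Y) n i
    (s : simplex n.+1 X) :
  push_simplex f (face i s) = face i (push_simplex f s).
Proof. by apply/continuousEP. Qed.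

Lemma chain_linear_ext (A : nzRingType) (X : topologicalType) n
    (M : lmodType A) (f g : {linear chain A n X -> M}) :
  (forall s, f << s >> = g << s >>) -> f =1 g.
Proof.
move=> fg c; rewrite -[c]freeg_sumE !linear_sum; apply: eq_bigr => s _.
suff -> : << coeff s c *g s >> = coeff s c *: << s >> :> {freeg _ / A}.
  by rewrite !linearZ fg.
by apply/eqP/freeg_eqP => t; rewrite coeffZ !coeffU mul1r.
Qed.

Lemma push_chainU (A : nzRingType) (X Y : topologicalType)
    (f : continuousType X Y) n (s : simplex n X) :
  push_chain A f n << s >> = << push_simplex f s >>.
Proof. by rewrite /push_chain /= liftU scale1r. Qed.

Lemma boundaryU (A : nzRingType) (X : topologicalType) n (s : simplex n.+1 X) :
  boundary A X n << s >> = \sum_(i < n.+2) (-1) ^+ i *: << face i s >>.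
Proof. by rewrite /boundary /= liftU scale1r. Qed.

Lemma push_chain_boundary (A : nzRingType) (X Y : topologicalType)
    (f : continuousType X Y) n (c : chain A n.+1 X) :
  push_chain A f n (boundary A X n c) = boundary A Y n (push_chain A f n.+1 c).
Proof.
apply: (@chain_linear_ext _ _ _ _ (push_chain A f n \o boundary A X n)
  (boundary A Y n \o push_chain A f n.+1)) => s /=.
rewrite boundaryU push_chainU boundaryU linear_sum; apply: eq_bigr => i _.
by rewrite linearZ/= push_chainU push_simplex_face.
Qed.

(* The chain map induced by the ring morphism int -> A on the coefficients. *)
Definition extend_chain (A : nzRingType) (X : topologicalType) n
    (c : chain int n X) : chain A n X :=
  \sum_(s <- dom c) (coeff s c)%:~R *: << s >>.

Lemma coeff_extend_chain (A : nzRingType) (X : topologicalType) n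
    (c : chain int n X) s :
  coeff s (extend_chain A c) = (coeff s c)%:~R.
Proof.
rewrite -[c in RHS]freeg_sumE /extend_chain !raddf_sum; apply: eq_bigr => t _.
by rewrite /= coeffZ !coeffU mul1r intrM; case: eqP.
Qed.

Fact extend_chain_zmod_morphism (A : nzRingType) (X : topologicalType) n :
  zmod_morphism (@extend_chain A X n).
Proof.
move=> c d; apply/eqP/freeg_eqP => s.
by rewrite coeffB !coeff_extend_chain coeffB intrB.
Qed.
HB.instance Definition _ (A : nzRingType) (X : topologicalType) n :=
  GRing.isZmodMorphism.Build _ _ (@extend_chain A X n)
    (@extend_chain_zmod_morphism A X n).

Lemma extend_chainZ (A : nzRingType) (X : topologicalType) n (a : int)
    (c : chain int n X) :
  extend_chain A (a *: c) = a%:~R *: extend_chain A c.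
Proof.
apply/eqP/freeg_eqP => s.
by rewrite coeffZ !coeff_extend_chain coeffZ intrM.
Qed.

Lemma extend_chainU (A : nzRingType) (X : topologicalType) n (s : simplex n X) :
  extend_chain A << s >> = << s >>.
Proof.
apply/eqP/freeg_eqP => t.
by rewrite coeff_extend_chain !coeffU !mul1r; case: eqP.
Qed.

Lemma extend_chain_boundary (A : nzRingType) (X : topologicalType) n
    (c : chain int n.+1 X) :
  extend_chain A (boundary int X n c) = boundary A X n (extend_chain A c).
Proof.
rewrite [in LHS](_ : c = \sum_(s <- dom c) coeff s c *: << s >>); last first.
  rewrite -[LHS]freeg_sumE; apply: eq_bigr => s _.
  by apply/eqP/freeg_eqP => t; rewrite coeffZ !coeffU mul1r.
rewrite linear_sum raddf_sum linear_sum; apply: eq_bigr => s _.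
rewrite !linearZ/= extend_chainZ; congr (_ *: _).
rewrite !boundaryU raddf_sum; apply: eq_bigr => i _.
rewrite /= extend_chainZ extend_chainU; congr (_ *: _).
by rewrite rmorphXn rmorphN1.
Qed.

Definition H1 (A : nzRingType) (X : topologicalType) : lmodType A :=
  homology (boundary A X 1) (boundary A X 0).

Definition H1_class (A : nzRingType) (X : topologicalType) (c : chain A 1 X)
    (dc : c \in is_cycle (boundary A X 0)) : H1 A X :=
  homology_class _ (Cycle dc).

Fact push_cycle (A : nzRingType) (X Y : topologicalType)
    (f : continuousType X Y) (z : cycle (boundary A X 0)) :
  push_chain A f 1 (val z) \in is_cycle (boundary A Y 0).
Proof.
case: z => c /=; rewrite !inE => /eqP dc.
by rewrite -push_chain_boundary dc linear0.
Qed.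

(* The map  f_* : H_1(X; A) -> H_1(Y; A). *)
Definition H1_push (A : nzRingType) (X Y : topologicalType)
    (f : continuousType X Y) (x : H1 A X) : H1 A Y :=
  H1_class (push_cycle f (repr x)).

Lemma H1_pushE (A : nzRingType) (X Y : topologicalType)
    (f : continuousType X Y) (z : cycle (boundary A X 0)) :
  H1_push f (homology_class _ z) = H1_class (push_cycle f z).
Proof.
apply/eqP/homology_classP => /=.
have /eqP/homology_classP[u du] :=
  homology_classK (homology_class (boundary A X 1) z).
by exists (push_chain A f 2 u); rewrite -push_chain_boundary du linearB.
Qed.

Fact extend_cycle (A : nzRingType) (X : topologicalType)
    (z : cycle (boundary int X 0)) :
  extend_chain A (val z) \in is_cycle (boundary A X 0).
Proof.
case: z => c /=; rewrite !inE => /eqP dc.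
by rewrite -extend_chain_boundary dc raddf0.
Qed.

(* The change of coefficients  H_1(X; Z) -> H_1(X; A). *)
Definition H1_extend (A : nzRingType) (X : topologicalType) (x : H1 int X) :
    H1 A X :=
  H1_class (extend_cycle A (repr x)).

Lemma H1_extendE (A : nzRingType) (X : topologicalType)
    (z : cycle (boundary int X 0)) :
  H1_extend A (homology_class _ z) = H1_class (extend_cycle A z).
Proof.
apply/eqP/homology_classP => /=.
have /eqP/homology_classP[u du] :=
  homology_classK (homology_class (boundary int X 1) z).
by exists (extend_chain A u); rewrite -extend_chain_boundary du raddfB.
Qed.

(* x is a generator: it is a basis of the free module H_1(X; A) of rank 1. *)
Definition H1_generator (A : nzRingType) (X : topologicalType) (x : H1 A X) :=
  bijective (fun a : A => a *: x).

End SingularChains.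

Lemma complex_continuous (R : realType) (T : topologicalType) (f g : T -> R) :
  continuous f -> continuous g ->
  continuous (fun x => (f x +i* g x)%C : R[i]^o).
Proof.
move=> fc gc x; apply/cvgrPdist_lt => e e0.
have [r r0 er] : exists2 r : R, 0 < r & e = (r%:C)%C.
  by move: e0; case: e => a b; rewrite ltcE/= => /andP[/eqP-> a0]; exists a.
have r2 : 0 < r / 2 by rewrite divr_gt0.
have /cvgrPdist_lt/(_ _ r2) fx := fc x.
have /cvgrPdist_lt/(_ _ r2) gx := gc x.
near=> y.
have -> : (f x +i* g x - (f y +i* g y))%C =
    ((f x - f y)%:C + 'i * (g x - g y)%:C)%C :> R[i].
  by apply/eqP; rewrite eq_complex/= !(mul0r, mul1r, mulr0, subr0, addr0, add0r)
    !eqxx.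
rewrite er (le_lt_trans (ler_normD _ _))// normrM.
have -> : `|'i%C| = 1 :> R[i] by rewrite normc_def/= expr0n expr1n add0r sqrtr1.
rewrite mul1r !normc_def/= expr0n/= !addr0 !sqrtr_sqr -rmorphD/= ltcR.
rewrite [ltRHS]splitr ltrD//; [near: y; exact: fx|near: y; exact: gx].
Unshelve. all: by end_near.
Qed.

Section CircleAndDisc.
Context (R : realType).

(* R[i]^o carries the topology of the norm of R[i], which has values in R[i]. *)
Definition circle : Type := [set z : R[i]^o | `|z| = 1].
HB.instance Definition _ := Topological.copy circle
  [set z : R[i]^o | `|z| = 1].

Definition disc : Type := [set z : R[i]^o | `|z| <= 1].
HB.instance Definition _ := Topological.copy disc
  [set z : R[i]^o | `|z| <= 1].

Definition circle_val (x : circle) : R[i] := set_val x.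
Definition disc_val (z : disc) : R[i] := set_val z.

Definition mk_circle (z : R[i]) (z1 : `|z| = 1) : circle :=
  exist _ (z : R[i]^o) (mem_set z1).
Definition mk_disc (z : R[i]) (z1 : `|z| <= 1) : disc :=
  exist _ (z : R[i]^o) (mem_set z1).

Fact circle_norm x : `|circle_val x| = 1. Proof. exact: (set_valP x). Qed.
Fact disc_norm z : `|disc_val z| <= 1. Proof. exact: (set_valP z). Qed.

Fact circle_neq0 x : circle_val x != 0.
Proof. by rewrite -normr_eq0 circle_norm oner_eq0. Qed.

Fact circle_val_inj : injective circle_val.
Proof. exact: val_inj. Qed.
Fact disc_val_inj : injective disc_val.
Proof. exact: val_inj. Qed.

Fact circle_one_subproof : `|1 : R[i]| = 1. Proof. exact: normr1. Qed.
Fact circle_mul_subproof x y : `|circle_val x * circle_val y| = 1.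
Proof. by rewrite normrM !circle_norm mulr1. Qed.
Fact circle_inv_subproof x : `|(circle_val x)^-1| = 1.
Proof. by rewrite normfV circle_norm invr1. Qed.
Fact circle_exp_subproof x (k : int) : `|circle_val x ^ k| = 1.
Proof.
by case: k => n; rewrite /exprz ?normfV normrX circle_norm expr1n ?invr1.
Qed.

Definition circle_one := mk_circle circle_one_subproof.
Definition circle_mul x y := mk_circle (circle_mul_subproof x y).
Definition circle_inv x := mk_circle (circle_inv_subproof x).

Fact circle_mulA : associative circle_mul.
Proof. by move=> x y z; apply: circle_val_inj; exact: mulrA. Qed.
Fact circle_mul1 : left_id circle_one circle_mul.
Proof. by move=> x; apply: circle_val_inj; exact: mul1r. Qed.
Fact circle_mulr1 : right_id circle_one circle_mul.
Proof. by move=> x; apply: circle_val_inj; exact: mulr1. Qed.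
Fact circle_mulV : left_inverse circle_one circle_inv circle_mul.
Proof. by move=> x; apply: circle_val_inj; exact/mulVf/circle_neq0. Qed.
Fact circle_mulrV : right_inverse circle_one circle_inv circle_mul.
Proof. by move=> x; apply: circle_val_inj; exact/mulfV/circle_neq0. Qed.
HB.instance Definition _ := isGroup.Build circle circle_mulA circle_mul1
  circle_mulr1 circle_mulV circle_mulrV.

Definition circle_exp (x : circle) (k : int) : circle :=
  mk_circle (circle_exp_subproof x k).

Fact disc_rot_subproof x z : `|circle_val x * disc_val z| <= 1.
Proof. by rewrite normrM circle_norm mul1r disc_norm. Qed.
Definition disc_rot (x : circle) (z : disc) : disc :=
  mk_disc (disc_rot_subproof x z).

Fact circle_disc_subproof x : `|circle_val x| <= 1.
Proof. by rewrite circle_norm. Qed.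
Definition circle_disc (x : circle) : disc := mk_disc (circle_disc_subproof x).

Fact disc_zero_subproof : `|0 : R[i]| <= 1. Proof. by rewrite normr0. Qed.
Definition disc_zero : disc := mk_disc disc_zero_subproof.
Definition disc_one : disc := circle_disc 1%g.

Fact circle_disc_continuous : continuous circle_disc.
Proof. by apply: set_type_continuous; exact: initial_continuous. Qed.

(* The singular 1-simplex  t |-> e^(2 pi i t_1),  which runs once around the
   circle, counterclockwise. *)
Fact circle_turn_subproof (t : R) :
  `|(cos (2 * pi * t) +i* sin (2 * pi * t))%C| = 1 :> R[i].
Proof. by rewrite normc_def /= cos2Dsin2 sqrtr1. Qed.
Definition circle_turn (t : std_simplex R 1) : circle :=
  mk_circle (circle_turn_subproof (set_val t 0 1)).

Fact circle_turn_continuous : continuous circle_turn.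
Proof.
have turnc : continuous (fun t : std_simplex R 1 => 2 * pi * set_val t 0 1).
  move=> t; apply: (@continuous_comp _ _ _ (@set_val _ (std_simplex R 1))
    (fun M : 'rV[R]_2 => 2 * pi * M 0 1)); first exact: initial_continuous.
  apply: (@cvgMl_tmp R _ _ (nbhs_filter (set_val t))).
  exact: coord_continuous.
apply: set_type_continuous; apply: complex_continuous => t.
  by apply: (continuous_comp (turnc t)); exact: continuous_cos.
by apply: (continuous_comp (turnc t)); exact: continuous_sin.
Qed.

Definition circle_simplex : simplex R 1 circle :=
  continuous_map circle_turn_continuous.

Fact circle_cycle (A : nzRingType) :
  << circle_simplex >> \in is_cycle (boundary R A circle 0).
Proof.
rewrite inE boundaryU 2!big_ord_recl big_ord0 addr0 expr0 expr1 scale1r.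
rewrite scaleN1r subr_eq0; apply/eqP; congr << _ >>; apply/continuousEP => t.
have [_ t1] : std_simplex R 0 (set_val t) by exact: set_valP.
rewrite big_ord1 in t1.
have i1 : 1 = fintype.lift ord0 ord0 :> 'I_2 by exact: val_inj.
have e0 : face_row ord0 (set_val t) 0 1 = 1 by rewrite mxE i1 liftK.
have e1 : face_row (fintype.lift ord0 ord0) (set_val t) 0 1 = 0.
  by rewrite mxE -i1 unlift_none.
apply: circle_val_inj; rewrite /= /circle_val /set_val /= e0 e1.
by rewrite mulr1 mulr0 cos0 sin0 mulr_natl cos2pi sin2pi.
Qed.

(* The fundamental class of the circle with its standard orientation. *)
Definition circle_class (A : nzRingType) : H1 R A circle :=
  H1_class (circle_cycle A).

End CircleAndDisc.

Section CircleActions.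
Context (R : realType).

(* A finite subgroup of the circle acts on X through an action of the circle. *)
Record circle_action (X : Type) := CircleAction {
  cact :> circle R -> X -> X;
  cact1 : forall x, cact 1%g x = x;
  cactM : forall a b x, cact (a * b)%g x = cact a (cact b x) }.

Record finite_circle_subgroup := FiniteCircleSubgroup {
  fcs_set :> {fset circle R};
  fcs_group : group_closed (mem fcs_set) }.

(* The number of cosets of H in G. *)
Definition subgroup_index (G H : finite_circle_subgroup) : nat :=
  #|` [fset [fset (x * y)%g | y in fcs_set H] | x in fcs_set G]|%fset.

Section Orbits.
Context (X : topologicalType) (G : finite_circle_subgroup).
Context (act : circle_action X).

Definition orbit_rel : rel X :=
  fun x y => [exists a : fcs_set G, act (val a) x == y].

Lemma orbit_relP x y :
  reflect (exists2 a, a \in fcs_set G & act a x = y) (orbit_rel x y).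
Proof.
apply: (iffP existsP) => [[a /eqP]|[a Ga <-]].
  by exists (val a) => //; exact: valP.
by exists [` Ga]%fset; rewrite /=.
Qed.

Fact orbit_rel_equiv : equiv_class_of orbit_rel.
Proof.
have [G1 GB] := fcs_group G; have GV := group_closedV (fcs_group G).
have GM := group_closedM (fcs_group G).
have sym x y : orbit_rel x y -> orbit_rel y x.
  move=> /orbit_relP[a Ga <-]; apply/orbit_relP; exists a^-1%g; first exact: GV.
  by rewrite -cactM mulVg cact1.
split=> [x|x y|y x z].
- by apply/orbit_relP; exists 1%g => //; rewrite cact1.
- by apply/idP/idP => /sym.
move=> /orbit_relP[a Ga <-] /orbit_relP[b Gb <-].
by apply/orbit_relP; exists (b * a)%g; [exact: GM|rewrite cactM].
Qed.
Canonical orbit_equiv := EquivRelPack orbit_rel_equiv.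

Definition orbit_space : Type := quotient_topology {eq_quot orbit_equiv}.
HB.instance Definition _ := Topological.copy orbit_space
  (quotient_topology {eq_quot orbit_equiv}).

Definition orbit_repr (u : orbit_space) : X :=
  repr (u : quotient_topology {eq_quot orbit_equiv}).

Definition orbit_pi : continuousType X orbit_space :=
  continuous_map (@pi_continuous X {eq_quot orbit_equiv}).

Lemma orbit_reprK : cancel orbit_repr orbit_pi.
Proof. exact: reprK. Qed.

Lemma orbit_piP x y :
  orbit_pi x = orbit_pi y <-> exists2 a, a \in fcs_set G & act a x = y.
Proof.
split=> [/eqP|xy].
  by move=> /eqP/eqmodP/orbit_relP.
by apply/eqmodP/orbit_relP.
Qed.

End Orbits.

Section InducedMap.
Context (X Y : topologicalType) (G H : finite_circle_subgroup).
Context (aX : circle_action X) (aY : circle_action Y).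
Context (f : continuousType X Y).
Hypothesis GH : (fcs_set G `<=` fcs_set H)%fset.
Hypothesis f_equiv : forall a x, f (aX a x) = aY a (f x).

Lemma orbit_map_spec x :
  orbit_pi H aY (f (orbit_repr (orbit_pi G aX x))) = orbit_pi H aY (f x).
Proof.
have /orbit_piP[a Ga ax] := orbit_reprK (orbit_pi G aX x).
apply/orbit_piP; exists a; first exact: (fsubsetP GH).
by rewrite -f_equiv ax.
Qed.

Fact orbit_map_continuous :
  continuous (fun u : orbit_space G aX => orbit_pi H aY (f (orbit_repr u))).
Proof.
apply/(@quotient_continuous X {eq_quot orbit_equiv G aX}).
rewrite (_ : _ \o _ = orbit_pi H aY \o f); first exact: cts_fun.
by apply/funext => x; exact: orbit_map_spec.
Qed.

(* The map  [x] |-> [f x]  from X/G to Y/H induced by f. *)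
Definition orbit_map : continuousType (orbit_space G aX) (orbit_space H aY) :=
  continuous_map orbit_map_continuous.

Lemma orbit_mapE x : orbit_map (orbit_pi G aX x) = orbit_pi H aY (f x).
Proof. exact: orbit_map_spec. Qed.

End InducedMap.

End CircleActions.

Section SolidTorus.
Context (R : realType).
Implicit Types G H : finite_circle_subgroup R.

Fact rot_action1 (x : circle R) : (1 * x = x)%g. Proof. exact: mul1g. Qed.
Fact rot_actionM (a b x : circle R) : (a * b * x = a * (b * x))%g.
Proof. by rewrite mulgA. Qed.
Definition rot_action : circle_action R (circle R) :=
  @CircleAction R _ (fun a x => a * x)%g rot_action1 rot_actionM.

Fact disc_action1 (z : disc R) : disc_rot 1%g z = z.
Proof. by apply: disc_val_inj; exact: mul1r. Qed.
Fact disc_actionM (a b : circle R) (z : disc R) :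
  disc_rot (a * b)%g z = disc_rot a (disc_rot b z).
Proof. by apply: disc_val_inj; apply/esym; exact: mulrA. Qed.
Definition disc_action : circle_action R (disc R) :=
  @CircleAction R _ (@disc_rot R) disc_action1 disc_actionM.

Section Power.
Context (k : int).
Fact pow_action1 (x : circle R) : (circle_exp 1%g k * x = x)%g.
Proof.
rewrite (_ : circle_exp 1%g k = 1%g) ?mul1g//.
by apply: circle_val_inj; exact: exp1rz.
Qed.
Fact pow_actionM (a b x : circle R) :
  (circle_exp (a * b)%g k * x = circle_exp a k * (circle_exp b k * x))%g.
Proof.
rewrite mulgA.
rewrite (_ : circle_exp (a * b)%g k = (circle_exp a k * circle_exp b k)%g)//.
by apply: circle_val_inj; exact: expfzMl.
Qed.
Definition pow_action : circle_action R (circle R) :=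
  @CircleAction R _ (fun a x => circle_exp a k * x)%g pow_action1 pow_actionM.
End Power.

Section Product.
Context (X Y : Type) (aX : circle_action R X) (aY : circle_action R Y).
Fact prod_action1 (u : X * Y) : (aX 1%g u.1, aY 1%g u.2) = u.
Proof. by case: u => x y /=; rewrite !cact1. Qed.
Fact prod_actionM (a b : circle R) (u : X * Y) :
  (aX (a * b)%g u.1, aY (a * b)%g u.2) =
  (aX a (aX b u.1, aY b u.2).1, aY a (aX b u.1, aY b u.2).2).
Proof. by rewrite /= !cactM. Qed.
Definition prod_action : circle_action R (X * Y)%type :=
  @CircleAction R _ (fun a u => (aX a u.1, aY a u.2)) prod_action1 prod_actionM.
End Product.

Definition solid_torus : topologicalType := (disc R * circle R)%type.
Definition torus : topologicalType := (circle R * circle R)%type.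

Definition solid_torus_action (k : int) : circle_action R solid_torus :=
  prod_action disc_action (pow_action k).
Definition torus_action (k : int) : circle_action R torus :=
  prod_action rot_action (pow_action k).

(* The natural quotient map  X/H -> X/G  for H included in G. *)
Definition orbit_quo (X : topologicalType) (act : circle_action R X) G H
    (HG : (fcs_set H `<=` fcs_set G)%fset) :
    continuousType (orbit_space H act) (orbit_space G act) :=
  orbit_map (f := idfun) HG (fun a x => erefl).

Fact fst_cts (X Y : topologicalType) : continuous (@fst X Y).
Proof. by move=> x; exact: cvg_fst. Qed.

Fact fst_equiv (X Y : topologicalType) (aX : circle_action R X)
    (aY : circle_action R Y) (a : circle R) (u : X * Y) :
  continuous_map (@fst_cts X Y) (prod_action aX aY a u) =
  aX a (continuous_map (@fst_cts X Y) u).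
Proof. by []. Qed.

Definition zeta k G :
    continuousType (orbit_space G (solid_torus_action k))
                   (orbit_space G disc_action) :=
  orbit_map (fsubset_refl _) (fst_equiv disc_action (pow_action k)).

(* The restriction of zeta over the boundary of the base. *)
Definition zeta_bd k G :
    continuousType (orbit_space G (torus_action k))
                   (orbit_space G rot_action) :=
  orbit_map (fsubset_refl _) (fst_equiv rot_action (pow_action k)).

Fact pair_cts (X Y Z : topologicalType) (f : X -> Y) (g : X -> Z) :
  continuous f -> continuous g -> continuous (fun x => (f x, g x)).
Proof.
by move=> fc gc x; exact: (@cvg_pair _ _ _ _ _ _ (nbhs_filter _)
  (nbhs_filter _) (nbhs_filter _) f g (fc x) (gc x)).
Qed.

Fact torus_incl_cts :
  continuous (fun u : torus => (circle_disc u.1, u.2) : solid_torus).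
Proof.
apply: pair_cts => u; last exact: cvg_snd.
apply: (@continuous_comp _ _ _ fst (@circle_disc R)); first exact: cvg_fst.
exact: circle_disc_continuous.
Qed.

Fact torus_incl_equiv k (a : circle R) (u : torus) :
  continuous_map torus_incl_cts (torus_action k a u) =
  solid_torus_action k a (continuous_map torus_incl_cts u).
Proof. by congr pair; exact: disc_val_inj. Qed.

Definition torus_incl k G :
    continuousType (orbit_space G (torus_action k))
                   (orbit_space G (solid_torus_action k)) :=
  orbit_map (fsubset_refl _) (torus_incl_equiv k).

Fact slice_cts (z : disc R) :
  continuous (fun x : circle R => (z, x) : solid_torus).
Proof.
apply: pair_cts.
  exact: (@cts_fun _ _ (@cst (circle R) (disc R) z : continuousType _ _)).
exact: (@cts_fun _ _ (@idfun (circle R) : continuousType _ _)).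
Qed.

(* s(x) = [1, x] *)
Definition fiber_one k G :
    continuousType (circle R) (orbit_space G (solid_torus_action k)) :=
  orbit_pi G (solid_torus_action k) \o continuous_map (@slice_cts (disc_one R)).

Fact slice_zero_equiv k (a x : circle R) :
  continuous_map (@slice_cts (disc_zero R)) (pow_action k a x) =
  solid_torus_action k a (continuous_map (@slice_cts (disc_zero R)) x).
Proof. by congr pair; apply: disc_val_inj; apply/esym; exact: mulr0. Qed.

(* s'([x]) = [0, x] *)
Definition fiber_zero k G :
    continuousType (orbit_space G (pow_action k))
                   (orbit_space G (solid_torus_action k)) :=
  orbit_map (fsubset_refl _) (slice_zero_equiv k).

(* The fundamental class of a circle C, oriented so that the covering q from the
   standard circle preserves orientations: the generator of H_1(C; Z) of which
   q_*[S^1] is a positive multiple. *)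
Definition fundamental_class (C : topologicalType)
    (q : continuousType (circle R) C) : H1 R int C :=
  xget 0 [set u : H1 R int C | H1_generator u /\
    exists2 m : nat, (0 < m)%N & H1_push q (circle_class R int) = u *+ m].

(* The rational homology classes of closed curves parameterized by the circle,
   and by the quotient of the circle by an action. *)
Definition loop_class (X : topologicalType) (c : continuousType (circle R) X) :
    H1 R rat X :=
  H1_push c (circle_class R rat).

Definition orbit_loop_class (X : topologicalType) G
    (act : circle_action R (circle R))
    (c : continuousType (orbit_space G act) X) : H1 R rat X :=
  H1_push c (H1_extend rat (fundamental_class (orbit_pi G act))).

(* c is a closed curve running once around F, when C is a circle. *)
Definition parameterizes (C X : topologicalType) (c : continuousType C X)
    (F : set X) : Prop :=
  injective c /\ range c = F.

End SolidTorus.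

(* Main.v *)
Require Import Defs.
From HB Require Import structures.
From mathcomp Require Import all_boot all_order all_algebra finmap.
From mathcomp Require Import freeg complex.
From mathcomp Require Import all_classical all_reals all_analysis.
From mathcomp Require Import zify ring lra.
Import Order.TTheory GRing.Theory Num.Theory.
Import numFieldNormedType.Exports.
Local Open Scope classical_set_scope.
Local Open Scope ring_scope.

Set Implicit Arguments.
Unset Strict Implicit.
Unset Printing Implicit Defensive.

(* The angular coordinate [z, x] |-> x^e with e = n / gcd(k, n) identifies
   H_1(T / Gamma; Q) with H_1(S^1; Q) = Q: it is the second component of the
   homeomorphism T / Gamma -> T induced by (z, x) |-> (z^d x^m, x^e), where
   d = gcd(k, n) and m is chosen so that m (k / d) = -1 modulo e.  A closed
   curve is therefore determined in homology by the degree of its angular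
   coordinate: e for s, 1 for s', and for a parameterized fiber e or 1 times
   the degree of a homeomorphism of the circle.  Comparing the angular
   coordinates of G o sigma_2 and sigma_1 o g gives
   [Gamma_1 : Gamma_2] deg sigma_1 = (e_1 / e_2) deg sigma_2.

   The identity H_1(T) = Z is obtained from the covering disc x R -> T.  Lifting
   simplices gives an integral winding cocycle, and coning the lifted paths
   makes every 1-simplex homologous to a multiple of the core circle plus a
   1-chain that only depends on its end points.  The circle is a retract of T. *)

(** * Real and complex coordinates *)

(** The orientation of a quotient circle is encoded by [fundamental_class], a generator of integral
    homology singled out by a sign condition. Rational homology cannot see this choice, so H_1 of
    the circle is needed over both the integers and the rationals; the homology of the circle and of
    T is therefore computed over an arbitrary coefficient ring. In (3) the two factors have separate
    origins. The n_i-th power identifies S^1 / Gamma_i with S^1 and turns g into the power map of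
    degree [Gamma_1 : Gamma_2]. In the angular coordinates G becomes the power map of degree e_1 /
    e_2. Since s_1 and s_2 have degrees e_1 and e_2, the ratio e_1 / e_2 also appears on the side of
    the fibers and cancels. Bijections onto quotients are never inverted by formulas: continuity of
    the inverse comes from compactness of the source and separation of the target. *)

Section ContinuousReal.
Context (R : realType) (X : topologicalType).
Implicit Types f g : X -> R.

Lemma continuous_add f g : continuous f -> continuous g ->
  continuous (fun x => f x + g x).
Proof. by move=> fc gc x; exact: (cvgD (fc x) (gc x)). Qed.

Lemma continuous_opp f : continuous f -> continuous (fun x => - f x).
Proof. by move=> fc x; exact: (cvgN (fc x)). Qed.

Lemma continuous_mul f g : continuous f -> continuous g ->
  continuous (fun x => f x * g x).
Proof. by move=> fc gc x; exact: (cvgM (fc x) (gc x)). Qed.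

Lemma continuous_inv f : (forall x, f x != 0) -> continuous f ->
  continuous (fun x => (f x)^-1).
Proof. by move=> f0 fc x; exact: (cvgV (f0 x) (fc x)). Qed.

Lemma continuous_abs f : continuous f -> continuous (fun x => `|f x|).
Proof.
by move=> fc x; apply: continuous_comp; [exact: fc|exact: norm_continuous].
Qed.

Lemma continuous_const (Y : topologicalType) (y : Y) : continuous (fun _ : X => y).
Proof. by move=> x; exact: cvg_cst. Qed.

Lemma continuous_compose (Y Z : topologicalType) (u : X -> Y) (v : Y -> Z) :
  continuous v -> continuous u -> continuous (fun x => v (u x)).
Proof. by move=> vc uc x; apply: continuous_comp; [exact: uc|exact: vc]. Qed.

Lemma continuous_bigsum (I : Type) (r : seq I) (F : I -> X -> R) :
  (forall i, continuous (F i)) -> continuous (fun x => \sum_(i <- r) F i x).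
Proof.
move=> Fc; elim: r => [|i r IHr].
  rewrite (_ : (fun _ => _) = fun=> 0); first exact: continuous_const.
  by apply/funext => x; rewrite big_nil.
rewrite (_ : (fun _ => _) = fun x => F i x + \sum_(i <- r) F i x).
  exact: continuous_add.
by apply/funext => x; rewrite big_cons.
Qed.

End ContinuousReal.

Section Clamp.
Context (R : realType).

(** The retraction of the line onto [0, 1]. Written with absolute values it is visibly continuous,
    and it extends paths and homotopies to all of [R] or [R * R], so that no subspace topology is
    needed. *)
Definition clamp (r : R) : R := (`|r| + 1 - `|r - 1|) / 2.

Lemma clamp_id r : 0 <= r <= 1 -> clamp r = r.
Proof.
by move=> /andP[r0 r1]; rewrite /clamp ger0_norm// ler0_norm ?subr_le0//; lra.
Qed.

Lemma clamp_ge1 r : 1 <= r -> clamp r = 1.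
Proof.
by move=> r1; rewrite /clamp ger0_norm ?ger0_norm ?subr_ge0//; lra.
Qed.

Lemma clamp_le0 r : r <= 0 -> clamp r = 0.
Proof.
by move=> r0; rewrite /clamp ler0_norm// ler0_norm; lra.
Qed.

Lemma clamp01 r : 0 <= clamp r <= 1.
Proof.
have [r0|/ltW r0] := leP r 0; first by rewrite clamp_le0// lexx ler01.
have [r1|/ltW r1] := leP r 1; first by rewrite clamp_id ?r0.
by rewrite clamp_ge1// lexx ler01.
Qed.

Lemma clamp_continuous : continuous clamp.
Proof.
apply: continuous_mul; last exact: continuous_const.
have idc : continuous (@idfun R) by move=> ?.
apply: continuous_add.
  by apply: continuous_add; [exact: continuous_abs|exact: continuous_const].
apply/continuous_opp/continuous_abs/continuous_add => //.
exact: continuous_const.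
Qed.

End Clamp.

Section ReIm.
Context (R : realType).

Lemma complex_Re_continuous : continuous (@complex.Re R : R[i]^o -> R).
Proof.
move=> z; have FT : Filter (nbhs z) := nbhs_filter z.
apply/(@cvgrPdist_lt _ _ _ _ (fmap_filter _ FT)) => e e0.
have e0' : 0 < e%:C%C :> R[i] by rewrite ltcR.
have /(@cvgrPdist_lt _ _ _ _ FT)/(_ _ e0') ze := @cvg_id _ (nbhs z).
apply: (@filterS _ (nbhs z) FT _ _ _ ze) => w /= zw.
rewrite -ltcR; apply: le_lt_trans zw.
by rewrite -raddfB; exact: normc_ge_Re.
Qed.

Lemma complex_Im_continuous : continuous (@complex.Im R : R[i]^o -> R).
Proof.
move=> z; have FT : Filter (nbhs z) := nbhs_filter z.
apply/(@cvgrPdist_lt _ _ _ _ (fmap_filter _ FT)) => e e0.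
have e0' : 0 < e%:C%C :> R[i] by rewrite ltcR.
have /(@cvgrPdist_lt _ _ _ _ FT)/(_ _ e0') ze := @cvg_id _ (nbhs z).
apply: (@filterS _ (nbhs z) FT _ _ _ ze) => w /= zw.
rewrite -ltcR; apply: le_lt_trans zw.
by rewrite -raddfB; rewrite normc_def lecR -(@sqrtr_sqr R) ler_wsqrtr// lerDr sqr_ge0.
Qed.

Definition circle_re (x : circle R) : R := complex.Re (circle_val x).
Definition circle_im (x : circle R) : R := complex.Im (circle_val x).
Definition disc_re (x : disc R) : R := complex.Re (disc_val x).
Definition disc_im (x : disc R) : R := complex.Im (disc_val x).

Lemma continuous_circle_reim (X : topologicalType) (f : X -> circle R) :
  continuous f -> continuous (fun x => circle_re (f x)) /\
                  continuous (fun x => circle_im (f x)).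
Proof.
move=> fc; have vc : continuous (fun x => set_val (f x) : R[i]^o).
  by apply: continuous_compose fc; exact: initial_continuous.
by split; [apply: (continuous_compose complex_Re_continuous vc)
          |apply: (continuous_compose complex_Im_continuous vc)].
Qed.

Lemma continuous_disc_reim (X : topologicalType) (f : X -> disc R) :
  continuous f -> continuous (fun x => disc_re (f x)) /\
                  continuous (fun x => disc_im (f x)).
Proof.
move=> fc; have vc : continuous (fun x => set_val (f x) : R[i]^o).
  by apply: continuous_compose fc; exact: initial_continuous.
by split; [apply: (continuous_compose complex_Re_continuous vc)
          |apply: (continuous_compose complex_Im_continuous vc)].
Qed.

Lemma circle_eq (x y : circle R) :
  circle_re x = circle_re y -> circle_im x = circle_im y -> x = y.
Proof.
move=> xy1 xy2; apply: circle_val_inj.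
by apply/eqP; rewrite eq_complex; apply/andP; split; apply/eqP.
Qed.

Lemma circle_re2im2 (x : circle R) : circle_re x ^+ 2 + circle_im x ^+ 2 = 1.
Proof.
have := circle_norm x; rewrite normc_def => -[] /(congr1 (fun t => t ^+ 2)).
by rewrite sqr_sqrtr ?expr1n// addr_ge0// sqr_ge0.
Qed.

Lemma circle_continuousP (X : topologicalType) (f : X -> circle R) :
  continuous (fun x => circle_re (f x)) -> continuous (fun x => circle_im (f x)) ->
  continuous f.
Proof.
move=> fr fi; apply: set_type_continuous.
rewrite (_ : (fun x => _) = fun x => (circle_re (f x) +i* circle_im (f x))%C).
  exact: complex_continuous.
by apply/funext => x; rewrite /circle_re /circle_im /circle_val; case: (set_val _).
Qed.

Lemma disc_continuousP (X : topologicalType) (f : X -> disc R) :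
  continuous (fun x => disc_re (f x)) -> continuous (fun x => disc_im (f x)) ->
  continuous f.
Proof.
move=> fr fi; apply: set_type_continuous.
rewrite (_ : (fun x => _) = fun x => (disc_re (f x) +i* disc_im (f x))%C).
  exact: complex_continuous.
by apply/funext => x; rewrite /disc_re /disc_im /disc_val; case: (set_val _).
Qed.

Lemma complex_ReM (z w : R[i]) : complex.Re (z * w) =
  complex.Re z * complex.Re w - complex.Im z * complex.Im w.
Proof. by case: z => a b; case: w. Qed.
Lemma complex_ImM (z w : R[i]) : complex.Im (z * w) =
  complex.Re z * complex.Im w + complex.Im z * complex.Re w.
Proof. by case: z => a b; case: w. Qed.

Lemma circle_reM (x y : circle R) : circle_re (x * y)%g =
  circle_re x * circle_re y - circle_im x * circle_im y.
Proof. exact: complex_ReM. Qed.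
Lemma circle_imM (x y : circle R) : circle_im (x * y)%g =
  circle_re x * circle_im y + circle_im x * circle_re y.
Proof. exact: complex_ImM. Qed.
Lemma circle_re1 : circle_re 1%g = 1. Proof. by []. Qed.
Lemma circle_im1 : circle_im 1%g = 0. Proof. by []. Qed.

Lemma circle_mulC (x y : circle R) : (x * y)%g = (y * x)%g.
Proof. by apply: circle_val_inj; exact: mulrC. Qed.

(** The hypotheses say (a + ib)(c + id) = 1 with a + ib of modulus 1; multiplying by the conjugate a
    - ib gives the result. *)
Lemma unit_pair_inv (a b c d : R) : a ^+ 2 + b ^+ 2 = 1 ->
  a * c - b * d = 1 -> a * d + b * c = 0 -> c = a /\ d = - b.
Proof.
move=> n1 h1 h2; split.
  transitivity ((a ^+ 2 + b ^+ 2) * c); first by rewrite n1 mul1r.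
  transitivity (a * (a * c - b * d) + b * (a * d + b * c)); first by ring.
  by rewrite h1 h2; ring.
transitivity ((a ^+ 2 + b ^+ 2) * d); first by rewrite n1 mul1r.
transitivity (a * (a * d + b * c) - b * (a * c - b * d)); first by ring.
by rewrite h1 h2; ring.
Qed.

Lemma circle_reimV (x : circle R) :
  circle_re x^-1%g = circle_re x /\ circle_im x^-1%g = - circle_im x.
Proof.
apply: unit_pair_inv; first exact: circle_re2im2.
  by rewrite -circle_reM mulgV.
by rewrite -circle_imM mulgV.
Qed.

Section Maps.
Context (X : topologicalType).

Lemma continuous_circle_mul (f g : X -> circle R) :
  continuous f -> continuous g -> continuous (fun x => f x * g x)%g.
Proof.
move=> /continuous_circle_reim[fr fi] /continuous_circle_reim[gr gi].
apply: circle_continuousP; under eq_fun do rewrite ?circle_reM ?circle_imM.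
  by apply: continuous_add; [|apply: continuous_opp]; apply: continuous_mul.
by apply: continuous_add; apply: continuous_mul.
Qed.

Lemma continuous_circle_inv (f : X -> circle R) :
  continuous f -> continuous (fun x => (f x)^-1)%g.
Proof.
move=> /continuous_circle_reim[fr fi]; apply: circle_continuousP.
  by under eq_fun do rewrite (circle_reimV _).1.
by under eq_fun do rewrite (circle_reimV _).2; exact: continuous_opp.
Qed.

Lemma continuous_circle_expg (f : X -> circle R) n :
  continuous f -> continuous (fun x => f x ^+ n)%g.
Proof.
move=> fc; elim: n => [|n IHn]; first exact: continuous_const.
rewrite (_ : (fun _ => _) = fun x => f x * f x ^+ n)%g.
  exact: continuous_circle_mul.
by apply/funext => x; rewrite expgS.
Qed.

End Maps.

Lemma cexp_subproof (t : R) : `|(cos t +i* sin t)%C| = 1 :> R[i].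
Proof. by rewrite normc_def /= cos2Dsin2 sqrtr1. Qed.
Definition cexp (t : R) : circle R := mk_circle (cexp_subproof t).

Lemma cexp_continuous : continuous cexp.
Proof. by apply: circle_continuousP; [exact: continuous_cos|exact: continuous_sin]. Qed.

Lemma circle_re_cexp t : circle_re (cexp t) = cos t. Proof. by []. Qed.
Lemma circle_im_cexp t : circle_im (cexp t) = sin t. Proof. by []. Qed.

Lemma cexpD s t : cexp (s + t) = (cexp s * cexp t)%g.
Proof.
apply: circle_eq; rewrite (circle_reM, circle_imM) /circle_re /circle_im /=.
  exact: cosD.
by rewrite sinD addrC.
Qed.

Lemma cexp0 : cexp 0 = 1%g.
Proof. by apply: circle_eq; rewrite /circle_re /circle_im /= (cos0, sin0). Qed.

Lemma cexpN t : cexp (- t) = (cexp t)^-1%g.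
Proof. by apply: (mulIg (cexp t)); rewrite -cexpD addNr cexp0 mulVg. Qed.

Lemma cexp_period : cexp (2 * pi) = 1%g.
Proof.
by rewrite mulr_natl; apply: circle_eq;
  rewrite (circle_re_cexp, circle_im_cexp) (cos2pi, sin2pi).
Qed.

Lemma cexp_natM t n : cexp (n%:R * t) = (cexp t ^+ n)%g.
Proof.
elim: n => [|n IHn]; first by rewrite mul0r cexp0.
by rewrite -[n.+1]add1n natrD mulrDl mul1r cexpD IHn expgS.
Qed.

Lemma cexp_int (n : int) : cexp (2 * pi * n%:~R) = 1%g.
Proof.
have natc (m : nat) : cexp (2 * pi * m%:R) = 1%g.
  by rewrite mulrC cexp_natM cexp_period expg1n.
case: n => n; first exact: natc.
by rewrite NegzE mulrNz mulrN cexpN natc invg1.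
Qed.

End ReIm.

(** * Lifting and winding of paths *)

Section Lifting.
Context (R : realType).

(** Removing the multiple of 2 pi given by the floor leaves u in [0, 2 pi). There cos u = 1 forces u
    = 0: cosine is injective on [0, pi], and the other half is reflected by 2 pi - u. *)
Lemma cexp_eq1 (t : R) : cexp t = 1%g -> exists n : int, t = 2 * pi * n%:~R.
Proof.
have pi0 := pi_gt0 R.
have small (u : R) : 0 <= u < 2 * pi -> cexp u = 1%g -> u = 0.
  move=> /andP[u0 u2] eu1.
  have cu : cos u = 1 by have := congr1 (@circle_re R) eu1.
  have [upi|piu] := leP u pi.
    by rewrite -(@cosK R u) ?cu ?acos1// in_itv/= u0.
  have c2u : cos (2 * pi - u) = 1.
    by rewrite cosB mulr_natl cos2pi sin2pi mul0r addr0 mul1r.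
  have : acos (cos (2 * pi - u)) = 2 * pi - u.
    by rewrite cosK// in_itv/=; apply/andP; split; lra.
  by rewrite c2u acos1; lra.
move=> et; set n := Num.floor (t / (2 * pi)); exists n.
have p2 : 0 < 2 * pi :> R by rewrite mulr_gt0.
have /andP[n1 n2] := floor_itv (t / (2 * pi)).
apply/eqP; rewrite -subr_eq0; apply/eqP; apply: small.
  rewrite subr_ge0 ltrBlDr -{2}[2 * pi]mulr1 -mulrDr [1 + _]addrC.
  rewrite -[1]/(1%:~R) -rmorphD/=.
  rewrite [2 * pi * _]mulrC [X in _ && (_ < X)]mulrC.
  by rewrite -ler_pdivlMr// -ltr_pdivrMr// n1.
by rewrite cexpD cexpN cexp_int et mul1g invg1.
Qed.

Lemma cexp_eq (s t : R) : cexp s = cexp t -> exists n : int, s = t + 2 * pi * n%:~R.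
Proof.
move=> est; have [|n st] := @cexp_eq1 (s - t).
  by rewrite cexpD cexpN est mulgV.
by exists n; rewrite -st addrC subrK.
Qed.

Lemma cexp_surj_itv (x : circle R) : exists2 t, - pi <= t <= pi & cexp t = x.
Proof.
have re2 := circle_re2im2 x; have pi0 := pi_ge0 R.
have re1 : -1 <= circle_re x <= 1.
  rewrite -ler_norml -(@ler_pXn2r _ 2)// ?nnegrE// expr1n.
  by rewrite real_normK ?num_real// -re2 lerDl sqr_ge0.
have ca : cos (acos (circle_re x)) = circle_re x by rewrite acosK// in_itv.
have sa : sin (acos (circle_re x)) = `|circle_im x|.
  by rewrite sin_acos// -re2 addrC addKr sqrtr_sqr.
have a0 := acos_ge0 re1; have api := acos_lepi re1.
have [i0|i0] := leP 0 (circle_im x).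
  exists (acos (circle_re x)); first by apply/andP; split; lra.
  by apply: circle_eq; rewrite (circle_re_cexp, circle_im_cexp) ?ca ?sa// ger0_norm.
exists (- acos (circle_re x)); first by apply/andP; split; lra.
apply: circle_eq; rewrite (circle_re_cexp, circle_im_cexp).
  by rewrite cosN.
by rewrite sinN sa ltr0_norm ?opprK.
Qed.

Lemma cexp_surj (x : circle R) : exists t, cexp t = x.
Proof. by have [t _ tx] := cexp_surj_itv x; exists t. Qed.

(** An arbitrary argument, with no continuity. The same choice enters [winding] and [ray_chain],
    which is what makes [homologous_chain] balance. *)
Definition carg (x : circle R) : R := xget 0 [set t | cexp t = x].

Lemma cargK x : cexp (carg x) = x.
Proof.
rewrite /carg; case: xgetP => [t -> //|no].
by have [t tx] := cexp_surj x; case: (no t).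
Qed.

(** The principal argument on the open right half plane, where it is continuous; it measures the
    small steps of a subdivision. *)
Definition half_arg (x : circle R) : R := atan (circle_im x / circle_re x).

Lemma half_argK x : 0 < circle_re x -> cexp (half_arg x) = x.
Proof.
move=> x0; have c : cos (half_arg x) = circle_re x.
  rewrite /half_arg cos_atan.
  rewrite (_ : 1 + _ = (circle_re x)^-1 ^+ 2).
    by rewrite sqrtr_sqr ger0_norm ?invrK// invr_ge0 ltW.
  rewrite -[1](@divff _ (circle_re x ^+ 2)) ?expf_neq0 ?gt_eqF//.
  by rewrite expr_div_n -mulrDl circle_re2im2 mul1r exprVn.
apply: circle_eq; rewrite (circle_re_cexp, circle_im_cexp); first exact: c.
have := atanK (circle_im x / circle_re x); rewrite -/(half_arg x) /tan c.
by move=> /(congr1 (fun u => u * circle_re x)); rewrite !divfK ?gt_eqF.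
Qed.

Lemma half_arg1 : half_arg 1%g = 0.
Proof. by rewrite /half_arg circle_im1 mul0r atan0. Qed.

(** For h = 0 the ratio is 1, with positive real part. By continuity and compactness of the unit
    square, positivity persists for all h below a uniform bound. *)
Lemma near_quotient (f : R * R -> circle R) : continuous f ->
  exists2 d : R, 0 < d & forall r y h, 0 <= r <= 1 -> 0 <= y <= 1 -> `|h| <= d ->
    0 < circle_re (f (r + h, y) * (f (r, y))^-1)%g.
Proof.
move=> fc.
pose G (u : R * R * R) := circle_re (f (u.1.1 + u.2, u.1.2) * (f u.1)^-1)%g.
have Gc : continuous G.
  apply: (continuous_circle_reim _).1.
  apply: continuous_circle_mul; last first.
    apply: continuous_circle_inv; apply: continuous_compose => //.
    by move=> u; exact: cvg_fst.
  apply: continuous_compose => //; apply: pair_cts.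
    apply: continuous_add; last by move=> u; exact: cvg_snd.
    by apply: continuous_compose => // u; exact: cvg_fst.
  by apply: continuous_compose => // u; [exact: cvg_snd|exact: cvg_fst].
have Kc : compact (`[0%R, 1%R]%classic `*` `[0%R, 1%R]%classic : set (R * R)%type).
  by apply: compact_setX; exact: segment_compact.
(* Quantifying over all h with |h| <= |d| makes the property monotone in d, so that one fixed value,
   later e / 2, handles every smaller increment. *)
have [e e0 Ke] : exists2 e : R, 0 < e & forall d : R, `|d| < e ->
    (`[0%R, 1%R]%classic `*` `[0%R, 1%R]%classic : set (R * R)%type) `<=`
    [set u | forall h, `|h| <= `|d| -> 0 < G (u, h)].
  move/compact_near_coveringP : Kc.
  move=> /(_ R (nbhs (0 : R)) (fun d u => forall h, `|h| <= `|d| -> 0 < G (u, h))).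
  move=> /(_ (nbhs_filter _)) K.
  have /nbhs_norm0P[e e0 eK] : \forall d \near (0 : R),
      (`[0%R, 1%R]%classic `*` `[0%R, 1%R]%classic : set (R * R)%type) `<=`
      (fun u => forall h, `|h| <= `|d| -> 0 < G (u, h)).
    apply: K => u Ku.
    have G0 : nbhs (u, 0 : R) (G @^-1` [set x | 0 < x]).
      apply: (Gc (u, 0)); apply: open_nbhs_nbhs; split; last first.
        by rewrite /= /G /= addr0 -surjective_pairing mulgV circle_re1.
      exact: open_gt.
    case: G0 => -[U V] /= [Uu /nbhs_norm0P[e e0 Ve]] UV.
    have W : \forall d \near (0 : R), `|d| < e by apply/nbhs_norm0P; exists e.
    exists (U, [set d | `|d| < e]); first by split.
    move=> [v d] /= [Uv de] h hd; apply: (UV (v, h)); split => //=.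
    by apply: Ve; exact: le_lt_trans de.
  by exists e.
exists (e / 2) => [|r y h r1 y1 hd]; first by rewrite divr_gt0.
have e2 : `|e / 2| = e / 2 by rewrite ger0_norm// divr_ge0 ?ltW.
apply: (Ke (e / 2) _ (r, y)); rewrite ?e2//=; first by rewrite ltr_pdivrMr//; lra.
Qed.

(* Subdivide so finely that the ratios of consecutive values lie in the right
   half plane, and add up their principal arguments. *)
Lemma lift_square (f : R * R -> circle R) (t : R) : continuous f ->
  (forall y, 0 <= y <= 1 -> f (0, y) = cexp t) ->
  exists L : R * R -> R, [/\ continuous L,
    forall r y, 0 <= r <= 1 -> 0 <= y <= 1 -> cexp (L (r, y)) = f (r, y) &
    forall y, L (0, y) = t].
Proof.
move=> fc f0; have [d d0 dP] := near_quotient fc.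
pose N := (Num.bound d^-1).
have dN : d^-1 < N%:R by apply: archi_boundP; rewrite invr_ge0 ltW.
have N0 : 0 < N%:R :> R by apply: lt_trans dN; rewrite invr_gt0.
have Nd : N%:R^-1 <= d by rewrite -[d]invrK lef_pV2 ?posrE ?invr_gt0// ltW.
(* For each point (r, y) the segment from (0, y) to (r, y) is cut into N equal pieces. The
   subdivision moves continuously with r, so the sum of the small arguments is continuous in both
   variables, and it is empty of increments when r = 0. *)
pose F (u : R * R) (j : nat) := f (clamp u.1 * (j%:R / N%:R), clamp u.2).
have fstc : continuous (fun u : R * R => clamp u.1).
  apply: continuous_compose; first exact: clamp_continuous.
  by move=> u; exact: cvg_fst.
have sndc : continuous (fun u : R * R => clamp u.2).
  apply: continuous_compose; first exact: clamp_continuous.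
  by move=> u; exact: cvg_snd.
have Fc j : continuous (fun u => F u j).
  apply: continuous_compose => //; apply: pair_cts => //.
  by apply: continuous_mul => //; exact: continuous_const.
pose a u j := half_arg (F u j.+1 * (F u j)^-1)%g.
have ratio u j : (j < N)%N -> 0 < circle_re (F u j.+1 * (F u j)^-1)%g.
  move=> jN; have /andP[c0 c1] := clamp01 u.1.
  rewrite /F (_ : clamp u.1 * (j.+1%:R / N%:R) =
    clamp u.1 * (j%:R / N%:R) + clamp u.1 / N%:R); last first.
    by rewrite -natr1; field; rewrite gt_eqF.
  apply: dP; last 1 first.
  - rewrite ger0_norm; last by rewrite divr_ge0// ltW.
    apply: (le_trans _ Nd).
    by rewrite ler_piMl// invr_ge0 ltW.
  - have j1 : 0 <= (j%:R / N%:R : R) <= 1.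
      by rewrite divr_ge0 ?ler0n//= ler_pdivrMr// mul1r ler_nat ltnW.
    move/andP: j1 => [j0 j1].
    by rewrite mulr_ge0//= -[leRHS]mulr1 ler_pM.
  - exact: clamp01.
exists (fun u => t + \sum_(j < N) a u j); split.
- apply: continuous_add; first exact: continuous_const.
  apply: continuous_bigsum => j.
  rewrite /a /half_arg; apply: continuous_compose; first exact: continuous_atan.
  apply: continuous_mul.
    apply: (continuous_circle_reim _).2.
    by apply: continuous_circle_mul => //; exact: continuous_circle_inv.
  apply: continuous_inv => [u|]; first by rewrite gt_eqF// ratio.
  apply: (continuous_circle_reim _).1.
  by apply: continuous_circle_mul => //; exact: continuous_circle_inv.
- move=> r y r1 y1; pose u := (r, y).
  have sumE m : (m <= N)%N ->
      cexp (\sum_(j < m) a u j) = (F u m * (F u 0%N)^-1)%g.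
    elim: m => [|m IHm] mN; first by rewrite big_ord0 mulgV cexp0.
    rewrite big_ord_recr /= addrC cexpD IHm ?(ltnW mN)// /a half_argK ?ratio//.
    by rewrite mulgA mulgVK.
  rewrite cexpD sumE// -(f0 y)// circle_mulC /F /= clamp_id// clamp_id//.
  by rewrite mul0r mulr0 divff ?gt_eqF// mulr1 mulgVK.
- move=> y; rewrite big1 ?addr0// => j _; rewrite /a /F /= clamp_le0// !mul0r.
  by rewrite mulgV half_arg1.
Qed.

Lemma lift_path (p : R -> circle R) (t : R) : continuous p -> p 0 = cexp t ->
  exists L : R -> R, [/\ continuous L, forall u, 0 <= u <= 1 -> cexp (L u) = p u &
    L 0 = t].
Proof.
move=> pc p0.
have [||L [Lc Lp L0]] := @lift_square (fun u => p u.1) t.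
- by apply: continuous_compose => // u; exact: cvg_fst.
- by [].
exists (fun u => L (u, 0)); split => [|u u1|]; last exact: L0.
  apply: continuous_compose => //; apply: pair_cts; first by move=> ?.
  exact: continuous_const.
by rewrite Lp ?lexx ?ler01.
Qed.

(** The difference divided by 2 pi is continuous and integer valued on [0, 1]. If its end values
    differed, the intermediate value theorem would produce a half-integer. *)
Lemma lift_unique (L L' : R -> R) : continuous L -> continuous L' ->
  (forall u, 0 <= u <= 1 -> cexp (L u) = cexp (L' u)) -> L 1 - L 0 = L' 1 - L' 0.
Proof.
move=> Lc Lc' LL'; pose g u := (L u - L' u) / (2 * pi).
have p2 : 0 < 2 * pi :> R by rewrite mulr_gt0 ?pi_gt0.
have gc : continuous g.
  apply: continuous_mul; last exact: continuous_const.
  by apply: continuous_add => //; exact: continuous_opp.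
have gint u : 0 <= u <= 1 -> exists n : int, g u = n%:~R.
  move=> /LL'/cexp_eq[n Lu]; exists n; rewrite /g Lu addrC addKr.
  by rewrite mulrC mulKf ?gt_eqF.
have no (n : int) : ~~ (Num.min (g 0) (g 1) <= n%:~R - 2^-1 <= Num.max (g 0) (g 1)).
  apply/negP => /(@IVT R g 0 1 _ ler01)[|c].
    exact: continuous_subspaceT.
  rewrite in_itv/= => /gint[m ->] mn.
  have : (m * 2 - n * 2 + 1)%:~R = 0 :> R.
    by rewrite rmorphD rmorphB !rmorphM/= mn -[2%:~R]/(2%:R); field.
  by move=> /eqP; rewrite intr_eq0 => /eqP; lia.
have [|a ga] := @gint 0; first by rewrite lexx ler01.
have [|b gb] := @gint 1; first by rewrite lexx ler01.
suff ab : a = b.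
  have : g 0 = g 1 by rewrite ga gb ab.
  by rewrite /g => /(mulIf (invr_neq0 (lt0r_neq0 p2))); lra.
have [lt|lt|//] := ltgtP a b.
- have := no b; rewrite ga gb => /negP[].
  have ab := ltW lt; rewrite min_l ?max_r ?ler_int//; apply/andP; split; last by lra.
  by have : a%:~R + 1 <= b%:~R :> R; [rewrite -[1]/(1%:~R) -rmorphD ler_int; lia|lra].
- have := no a; rewrite ga gb => /negP[].
  have ba := ltW lt; rewrite min_r ?max_l ?ler_int//; apply/andP; split; last by lra.
  by have : b%:~R + 1 <= a%:~R :> R; [rewrite -[1]/(1%:~R) -rmorphD ler_int; lia|lra].
Qed.

Definition is_lift (p : R -> circle R) (L : R -> R) :=
  continuous L /\ forall u, 0 <= u <= 1 -> cexp (L u) = p u.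

(* Subtracting the chosen arguments of the end points makes the increment of a
   lift an integral cocycle, hence available for all coefficient rings. *)
Definition winding (p : R -> circle R) : int :=
  xget 0 [set w : int | forall L, is_lift p L ->
    L 1 - L 0 = carg (p 1) - carg (p 0) + 2 * pi * w%:~R].

(** As soon as one lift exists, the default of [xget] is excluded: the end points fix the increment
    modulo 2 pi, and by [lift_unique] every other lift has the same increment. *)
Lemma windingP p L : is_lift p L ->
  L 1 - L 0 = carg (p 1) - carg (p 0) + 2 * pi * (winding p)%:~R.
Proof.
rewrite /winding; case: xgetP => [w _ /(_ L)//|no] pL.
have [Lc Lp] := pL.
have [|n1 L1] := @cexp_eq (L 1) (carg (p 1)); first by rewrite Lp ?cargK// lexx ler01.
have [|n0 L0] := @cexp_eq (L 0) (carg (p 0)); first by rewrite Lp ?cargK// lexx ler01.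
exfalso; apply: (no (n1 - n0)) => L' [Lc' Lp'].
rewrite -(@lift_unique L L')// => [|u u1]; last by rewrite Lp ?Lp'.
by rewrite L1 L0 rmorphB/=; lra.
Qed.

Lemma winding_eq p L (w : int) : is_lift p L ->
  L 1 - L 0 = carg (p 1) - carg (p 0) + 2 * pi * w%:~R -> winding p = w.
Proof.
move=> /windingP-> /addrI/mulfI; move=> /(_ (lt0r_neq0 _)) h.
have /h /eqP : 0 < 2 * pi :> R by rewrite mulr_gt0 ?pi_gt0.
by rewrite eqr_int => /eqP.
Qed.

End Lifting.

(** * Singular chains *)

Section H1Functor.
Context (R : realType) (A : nzRingType).
Implicit Types X Y Z : topologicalType.

Lemma H1_exists_cycle X (x : H1 R A X) :
  exists z : Defs.cycle (boundary R A X 0), x = homology_class _ z.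
Proof. by exists (repr x); rewrite homology_classK. Qed.

Lemma H1_scaleE X (a : A) (z : Defs.cycle (boundary R A X 0)) :
  a *: homology_class (boundary R A X 1) z =
  homology_class (boundary R A X 1) (a *: z).
Proof. exact/esym/homology_class_scale. Qed.

Lemma H1_pushZ X Y (f : continuousType X Y) (a : A) (x : H1 R A X) :
  H1_push f (a *: x) = a *: H1_push f x.
Proof.
have [u ->] := H1_exists_cycle x.
rewrite H1_scaleE !H1_pushE /H1_class H1_scaleE.
by congr homology_class; apply: val_inj; rewrite /= linearZ.
Qed.

(** The composite is a separate map [h], only pointwise equal to g o f, so that it can be given as
    the identity or a power map. *)
Lemma H1_push_comp X Y Z (f : continuousType X Y) (g : continuousType Y Z)
  (h : continuousType X Z) (x : H1 R A X) : (forall u, g (f u) = h u) ->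
  H1_push g (H1_push f x) = H1_push h x.
Proof.
move=> gf; have [[c dc] ->] := H1_exists_cycle x; rewrite !H1_pushE.
congr homology_class; apply: val_inj => /=.
apply: (@chain_linear_ext R A X 1 _ (push_chain R A g 1 \o push_chain R A f 1)
  (push_chain R A h 1)) => s /=.
by rewrite !push_chainU; congr << _ >>; apply/continuousEP => t; exact: gf.
Qed.

Lemma H1_push_id X (f : continuousType X X) (x : H1 R A X) :
  (forall u, f u = u) -> H1_push f x = x.
Proof.
move=> fid; have [[c dc] ->] := H1_exists_cycle x; rewrite !H1_pushE.
congr homology_class; apply: val_inj => /=.
apply: (@chain_linear_ext R A X 1 _ (push_chain R A f 1) idfun) => s /=.
by rewrite push_chainU; congr << _ >>; apply/continuousEP => t; exact: fid.
Qed.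

End H1Functor.

Section H1Extend.
Context (R : realType) (A : nzRingType).
Implicit Types X Y : topologicalType.

Lemma extend_chain_push X Y (f : continuousType X Y) n (c : chain R int n X) :
  extend_chain A (push_chain R int f n c) = push_chain R A f n (extend_chain A c).
Proof.
rewrite [in LHS](_ : c = \sum_(s <- dom c) coeff s c *: << s >>); last first.
  rewrite -[LHS]freeg_sumE; apply: eq_bigr => s _.
  by apply/eqP/freeg_eqP => t; rewrite coeffZ !coeffU mul1r.
rewrite linear_sum raddf_sum linear_sum; apply: eq_bigr => s _.
rewrite !linearZ/= extend_chainZ; congr (_ *: _).
by rewrite !push_chainU extend_chainU.
Qed.

Lemma H1_push_extend X Y (f : continuousType X Y) (x : H1 R int X) :
  H1_push f (H1_extend A x) = H1_extend A (H1_push f x).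
Proof.
have [z ->] := H1_exists_cycle x; rewrite H1_pushE !H1_extendE H1_pushE.
by congr homology_class; apply: val_inj => /=; rewrite extend_chain_push.
Qed.

Lemma H1_extend_circle : H1_extend A (circle_class R int) = circle_class R A.
Proof.
rewrite /circle_class {1}/H1_class H1_extendE; congr homology_class.
by apply: val_inj => /=; rewrite extend_chainU.
Qed.

End H1Extend.

(** * Paths and triangles as singular simplices *)

Section SimplexCoordinates.
Context (R : realType).

Lemma continuous_row (X : topologicalType) n (f : X -> 'rV[R]_n.+1) :
  (forall j, continuous (fun x => f x 0 j)) -> continuous f.
Proof.
move=> fc x; have FT : Filter (nbhs x) := nbhs_filter x.
have FF := fmap_filter f FT.
apply/cvg_mx_entourageP => B entB.
have tB : \forall s \near x, forall j, (f x 0 j, f s 0 j) \in B.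
  apply: (@filter_forall _ _ (fun j s => (f x 0 j, f s 0 j) \in B) (nbhs x)) => j.
  have /cvg_entourageP/(_ _ entB) := fc j x.
  by move=> tB; apply: (@filterS _ (nbhs x) FT _ _ _ tB) => s /=; rewrite inE.
by apply: filterS tB => s sB k j; rewrite ord1.
Qed.

(** Natural number indices allow points of a simplex to be compared by cases on k, without reasoning
    on ordinals. *)
Definition coord n (t : std_simplex R n) (k : nat) : R := set_val t 0 (inord k).

Lemma continuous_coord n k : continuous (@coord n ^~ k).
Proof.
move=> t; apply: (@continuous_comp _ _ _ (@set_val _ (std_simplex R n))
  (fun M : 'rV[R]_n.+1 => M 0 (inord k))); first exact: initial_continuous.
exact: coord_continuous.
Qed.

Lemma coord_ge0 n (t : std_simplex R n) k : 0 <= coord t k.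
Proof.
have [t0 _] : std_simplex R n (set_val t) by exact: set_valP.
exact: t0.
Qed.

Lemma coord_sum n (t : std_simplex R n) : \sum_(0 <= k < n.+1) coord t k = 1.
Proof.
have [_ t1] : std_simplex R n (set_val t) by exact: set_valP.
by rewrite big_mkord -[RHS]t1; apply: eq_bigr => i _; rewrite /coord inord_val.
Qed.

Lemma coord_inj n (t t' : std_simplex R n) :
  (forall k, (k <= n)%N -> coord t k = coord t' k) -> t = t'.
Proof.
move=> tt'; apply: val_inj; apply/rowP => j.
by have := tt' j (ltn_ord j); rewrite /coord inord_val.
Qed.

Section Mk.
Context (n : nat) (f : nat -> R).
Hypothesis f0 : forall k, 0 <= f k.
Hypothesis f1 : \sum_(0 <= k < n.+1) f k = 1.
Lemma simplex_point_subproof : \row_(j < n.+1) f j \in std_simplex R n.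
Proof.
apply/mem_set; split=> [j|]; rewrite ?mxE//.
by rewrite -[RHS]f1 big_mkord; apply: eq_bigr => i _; rewrite mxE.
Qed.
Definition simplex_point : std_simplex R n := 
  exist _ (\row_(j < n.+1) f j) simplex_point_subproof.
Lemma coord_simplex_point k : (k <= n)%N -> coord simplex_point k = f k.
Proof. by move=> kn; rewrite /coord mxE inordK. Qed.
End Mk.

Lemma coord_coface n (i k : nat) (t : std_simplex R n) :
  (i <= n.+1)%N -> (k <= n.+1)%N ->
  coord (coface (inord i) t) k = if k == i then 0 else coord t (unbump i k).
Proof.
move=> iN kN; rewrite /coord mxE; case: unliftP => [j kj|ki].
  have kE : k = bump i j by rewrite -(@inordK n.+1 k)// kj /= inordK.
  rewrite kE eq_sym (negbTE (neq_bump _ _)) bumpK inord_val//.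
by rewrite -(@inordK n.+1 k)// ki inordK// eqxx.
Qed.

Lemma continuous_simplex n (X : topologicalType) (f : X -> std_simplex R n) :
  (forall k, (k <= n)%N -> continuous (fun x => coord (f x) k)) -> continuous f.
Proof.
move=> fc; apply: set_type_continuous; apply: continuous_row => j.
by have := fc j (ltn_ord j); rewrite /coord inord_val.
Qed.

Definition edge_coord (u : R) (k : nat) : R := nth 0 [:: 1 - clamp u; clamp u] k.
Lemma edge_coord_ge0 u k : 0 <= edge_coord u k.
Proof.
have /andP[c0 c1] := clamp01 u.
by case: k => [|[|k]] //=; rewrite /edge_coord/= ?subr_ge0 ?nth_nil.
Qed.
Lemma edge_coord_sum u : \sum_(0 <= k < 2) edge_coord u k = 1.
Proof. by rewrite big_nat_recr// big_nat1 /edge_coord/= subrK. Qed.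
Definition edge u : std_simplex R 1 :=
  simplex_point (edge_coord_ge0 u) (edge_coord_sum u).

Lemma edge_continuous : continuous edge.
Proof.
apply: continuous_simplex => -[|[|//]] _.
  rewrite (_ : (fun _ => _) = fun u => 1 - clamp u).
    apply: continuous_add; first exact: continuous_const.
    exact/continuous_opp/clamp_continuous.
  by apply/funext => u; rewrite coord_simplex_point.
rewrite (_ : (fun _ => _) = @clamp R); first exact: clamp_continuous.
by apply/funext => u; rewrite coord_simplex_point.
Qed.

Lemma coord1_01 (t : std_simplex R 1) : 0 <= coord t 1 <= 1.
Proof.
have := coord_sum t; rewrite big_nat_recr// big_nat1/= => <-.
by rewrite coord_ge0/= lerDr coord_ge0.
Qed.

Lemma edgeK (t : std_simplex R 1) : edge (coord t 1) = t.
Proof.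
have t1 := coord1_01 t; have := coord_sum t; rewrite big_nat_recr// big_nat1/= => s1.
apply: coord_inj => -[|[|//]] _; rewrite coord_simplex_point// /edge_coord/= clamp_id//.
by rewrite -s1 addrK.
Qed.

Lemma coord_edge u : 0 <= u <= 1 -> coord (edge u) 1 = u.
Proof. by move=> u1; rewrite coord_simplex_point// /edge_coord/= clamp_id. Qed.

Lemma edge_ext (X : topologicalType) (s s' : simplex R 1 X) :
  (forall u, 0 <= u <= 1 -> s (edge u) = s' (edge u)) -> s = s'.
Proof.
move=> ss'; apply/continuousEP => t; rewrite -[t]edgeK; apply: ss'.
exact: coord1_01.
Qed.

(* Polar coordinates centred at vertex 0: the side u.1 = 0 collapses to that
   vertex and the other three sides are the faces. *)
Definition square_coord (u : R * R) (k : nat) : R :=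
  nth 0 [:: 1 - clamp u.1; clamp u.1 * (1 - clamp u.2); clamp u.1 * clamp u.2] k.
Lemma square_coord_ge0 u k : 0 <= square_coord u k.
Proof.
have /andP[c0 c1] := clamp01 u.1; have /andP[d0 d1] := clamp01 u.2.
case: k => [|[|[|k]]]; rewrite /square_coord/= ?nth_nil//.
- by rewrite subr_ge0.
- by rewrite mulr_ge0// subr_ge0.
- exact: mulr_ge0.
Qed.
Lemma square_coord_sum u : \sum_(0 <= k < 3) square_coord u k = 1.
Proof. by rewrite !big_nat_recr//= big_geq// /square_coord/=; ring. Qed.
Definition square u : std_simplex R 2 :=
  simplex_point (square_coord_ge0 u) (square_coord_sum u).

Lemma square_continuous : continuous square.
Proof.
have c1 : continuous (fun u : R * R => clamp u.1).
  apply: continuous_compose; first exact: clamp_continuous.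
  by move=> u; exact: cvg_fst.
have c2 : continuous (fun u : R * R => clamp u.2).
  apply: continuous_compose; first exact: clamp_continuous.
  by move=> u; exact: cvg_snd.
apply: continuous_simplex => k k2.
rewrite (_ : (fun _ => _) = square_coord^~ k); last first.
  by apply/funext => u; rewrite coord_simplex_point.
have cc := @continuous_const R.
case: k k2 => [|[|[|//]]] _; rewrite /square_coord/=.
- by apply: continuous_add; [exact: continuous_const|exact: continuous_opp].
- apply: continuous_mul => //.
  by apply: continuous_add; [exact: continuous_const|exact: continuous_opp].
- exact: continuous_mul.
Qed.

Lemma square0 y y' : square (0, y) = square (0, y').
Proof.
by apply: coord_inj => -[|[|[|//]]] _; rewrite !coord_simplex_point// /square_coord/=
  clamp_le0// !mul0r.
Qed.

Lemma face0_square u : coface (inord 0) (edge u) = square (1, u).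
Proof.
by apply: coord_inj => -[|[|[|//]]] _; rewrite coord_coface//= !coord_simplex_point//
  /square_coord /edge_coord/= ?(@clamp_ge1 _ 1)// ?(subrr, subr0, mul1r, mulr1, mulr0).
Qed.
Lemma face1_square u : coface (inord 1) (edge u) = square (u, 1).
Proof.
by apply: coord_inj => -[|[|[|//]]] _; rewrite coord_coface//= !coord_simplex_point//
  /square_coord /edge_coord/= ?(@clamp_ge1 _ 1)// ?(subrr, subr0, mul1r, mulr1, mulr0).
Qed.
Lemma face2_square u : coface (inord 2) (edge u) = square (u, 0).
Proof.
by apply: coord_inj => -[|[|[|//]]] _; rewrite coord_coface//= !coord_simplex_point//
  /square_coord /edge_coord/= ?(@clamp_le0 _ 0)// ?(subrr, subr0, mul1r, mulr1, mulr0).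
Qed.

End SimplexCoordinates.

Section Paths.
Context (R : realType).
Implicit Types X : topologicalType.

Fact path_simplex_continuous X (p : R -> X) : continuous p ->
  continuous (fun t : std_simplex R 1 => p (coord t 1)).
Proof. by move=> pc; apply: continuous_compose => //; exact: continuous_coord. Qed.

Definition path_simplex X (p : R -> X) (pc : continuous p) : simplex R 1 X :=
  continuous_map (path_simplex_continuous pc).

Lemma path_simplex_edge X (p : R -> X) (pc : continuous p) u : 0 <= u <= 1 ->
  path_simplex pc (edge u) = p u.
Proof. by move=> u1; rewrite /path_simplex/= coord_edge. Qed.

Lemma simplex_edge_continuous X (s : simplex R 1 X) : continuous (fun u => s (edge u)).
Proof. by apply: continuous_compose; [exact: cts_fun|exact: edge_continuous]. Qed.

Fact triangle_simplex_continuous X (F : R * R -> X) : continuous F ->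
  continuous (fun t : std_simplex R 2 => F (coord t 1, coord t 2)).
Proof.
move=> Fc; apply: continuous_compose => //.
by apply: pair_cts; exact: continuous_coord.
Qed.

Definition triangle_simplex X (F : R * R -> X) (Fc : continuous F) : simplex R 2 X :=
  continuous_map (triangle_simplex_continuous Fc).

Definition point_simplex X (x : X) : simplex R 0 X :=
  continuous_map (@continuous_const _ _ x).

Lemma sum_inord (V : nmodType) n (F : 'I_n.+1 -> V) :
  \sum_(i < n.+1) F i = \sum_(0 <= i < n.+1) F (inord i).
Proof. by rewrite big_mkord; apply: eq_bigr => i _; rewrite inord_val. Qed.

Lemma boundary1 (A : nzRingType) X (s : simplex R 1 X) :
  boundary R A X 0 << s >> =
  << point_simplex (s (edge 1)) >> - << point_simplex (s (edge 0)) >>.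
Proof.
rewrite boundaryU sum_inord big_nat_recr// big_nat1/= !inordK//.
rewrite expr0 expr1 scale1r scaleN1r.
congr (<< _ >> - << _ >>); apply/continuousEP => t /=; congr (s _).
  apply: coord_inj => k k1; rewrite coord_coface// coord_simplex_point//.
  have := coord_sum t; rewrite big_nat1 => t1.
  by case: k k1 => [|[|//]] _; rewrite /edge_coord/= clamp_ge1// subrr.
apply: coord_inj => k k1; rewrite coord_coface// coord_simplex_point//.
have := coord_sum t; rewrite big_nat1 => t1.
by case: k k1 => [|[|//]] _; rewrite /edge_coord/= clamp_le0// subr0.
Qed.

Lemma boundary2 (A : nzRingType) X (s : simplex R 2 X) :
  boundary R A X 1 << s >> =
  << face (inord 0) s >> - << face (inord 1) s >> + << face (inord 2) s >>.
Proof.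
rewrite boundaryU sum_inord !big_nat_recr//= big_geq// add0r !inordK//.
by rewrite expr0 expr1 scale1r scaleN1r sqrrN expr1n scale1r.
Qed.

(** The coordinates at vertices 1 and 2 place the simplex in the plane as the triangle (0, 0), (1,
    0), (0, 1); the face opposite to vertex 0 is the hypotenuse. *)
Lemma boundary_triangle (A : nzRingType) X (F : R * R -> X) (Fc : continuous F)
    (p0 p1 p2 : simplex R 1 X) :
  (forall u, 0 <= u <= 1 -> p0 (edge u) = F (1 - u, u)) ->
  (forall u, 0 <= u <= 1 -> p1 (edge u) = F (0, u)) ->
  (forall u, 0 <= u <= 1 -> p2 (edge u) = F (u, 0)) ->
  boundary R A X 1 << triangle_simplex Fc >> = << p0 >> - << p1 >> + << p2 >>.
Proof.
move=> e0 e1 e2; rewrite boundary2; congr (<< _ >> - << _ >> + << _ >>);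
  apply: edge_ext => u u1; rewrite (e0, e1, e2)//=; congr F; congr pair;
  by rewrite coord_coface//= coord_simplex_point// /edge_coord/= clamp_id.
Qed.

End Paths.

(** * The winding cocycle on the circle *)

Section WindingClass.
Context (R : realType) (A : nzRingType).

Definition simplex_winding (s : simplex R 1 (circle R)) : int :=
  winding (fun u => s (edge u)).

Lemma simplex_winding_lift (s : simplex R 1 (circle R)) (L : R -> R) :
  is_lift (fun u => s (edge u)) L ->
  L 1 - L 0 = carg (s (edge 1)) - carg (s (edge 0)) + 2 * pi * (simplex_winding s)%:~R.
Proof. exact: windingP. Qed.

(** One lift over the polar square restricts to lifts of the three faces, and it is constant on the
    collapsed side. The increments of these lifts have alternating sum 0, and so do the chosen
    arguments of the vertices. *)
Lemma simplex_winding_cocycle (s : simplex R 2 (circle R)) :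
  simplex_winding (face (inord 0) s) - simplex_winding (face (inord 1) s)
  + simplex_winding (face (inord 2) s) = 0.
Proof.
have [t st] := cexp_surj (s (square (0, 0))).
have sc : continuous (fun u => s (square u)).
  by apply: continuous_compose; [exact: cts_fun|exact: square_continuous].
have [|L [Lc Ls L0]] := @lift_square _ _ t sc.
  by move=> y _; rewrite st (square0 y 0).
have r0 : 0 <= (0 : R) <= 1 by rewrite lexx ler01.
have r1 : 0 <= (1 : R) <= 1 by rewrite lexx ler01.
have idc : continuous (@idfun R) by move=> ?.
have cc (x : R) : continuous (fun _ : R => x) by exact: continuous_const.
have f0 (u : R) : face (inord 0) s (edge u) = s (square (1, u))
  by rewrite -face0_square.
have f1 (u : R) : face (inord 1) s (edge u) = s (square (u, 1))
  by rewrite -face1_square.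
have f2 (u : R) : face (inord 2) s (edge u) = s (square (u, 0))
  by rewrite -face2_square.
have l0 : is_lift (fun u => face (inord 0) s (edge u)) (fun u => L (1, u)).
  split=> [|u u1]; last by rewrite f0 Ls.
  by apply: continuous_compose => //; exact: pair_cts.
have l1 : is_lift (fun u => face (inord 1) s (edge u)) (fun u => L (u, 1)).
  split=> [|u u1]; last by rewrite f1 Ls.
  by apply: continuous_compose => //; exact: pair_cts.
have l2 : is_lift (fun u => face (inord 2) s (edge u)) (fun u => L (u, 0)).
  split=> [|u u1]; last by rewrite f2 Ls.
  by apply: continuous_compose => //; exact: pair_cts.
have := simplex_winding_lift l0; have := simplex_winding_lift l1.
have := simplex_winding_lift l2; rewrite !f0 !f1 !f2 !L0 (square0 1 0).
set w0 := simplex_winding (face (inord 0) s).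
set w1 := simplex_winding (face (inord 1) s).
set w2 := simplex_winding (face (inord 2) s) => h2 h1 h0.
have : 2 * pi * (w0 - w1 + w2)%:~R = 0 :> R.
  rewrite rmorphD rmorphB/= mulrDr mulrBr; move: h0 h1 h2.
  move: (2 * pi * w0%:~R) (2 * pi * w1%:~R) (2 * pi * w2%:~R) => a b c; lra.
move=> /eqP; rewrite mulf_eq0 intr_eq0 => /orP[|/eqP//].
by rewrite gt_eqF// mulr_gt0// pi_gt0.
Qed.

Definition winding_chain : {linear chain R A 1 (circle R) -> A^o} :=
  fglift (fun s => (simplex_winding s)%:~R : A^o).

Lemma winding_chainU s : winding_chain << s >> = (simplex_winding s)%:~R.
Proof. by rewrite /winding_chain/= liftU scale1r. Qed.

Lemma winding_chain_boundary c : winding_chain (boundary R A (circle R) 1 c) = 0.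
Proof.
apply: (@chain_linear_ext R A _ _ _
  (winding_chain \o boundary R A (circle R) 1) \0) => s /=.
rewrite boundary2 linearD linearB /= !winding_chainU.
by rewrite -rmorphB -rmorphD simplex_winding_cocycle.
Qed.

Definition winding_class (x : H1 R A (circle R)) : A := winding_chain (val (repr x)).

(** Independence of the representative: the cocycle vanishes on boundaries. *)
Lemma winding_classE z : winding_class (homology_class _ z) = winding_chain (val z).
Proof.
have /eqP/homology_classP[u du] :=
  homology_classK (homology_class (boundary R A (circle R) 1) z).
apply/eqP; rewrite -subr_eq0 /winding_class -linearB -du; apply/eqP.
exact: winding_chain_boundary.
Qed.

Lemma winding_classZ a x : winding_class (a *: x) = a * winding_class x.
Proof.
have [u ->] := H1_exists_cycle x.
by rewrite H1_scaleE !winding_classE linearZ.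
Qed.

Lemma simplex_winding_loop (s : simplex R 1 (circle R)) (m : nat) :
  (forall u, 0 <= u <= 1 -> s (edge u) = cexp (m%:R * (2 * pi * u))) ->
  simplex_winding s = m.
Proof.
move=> sE; apply: (@winding_eq _ _ (fun u => m%:R * (2 * pi * u))).
  split=> [|u u1]; last by rewrite sE.
  apply: continuous_mul; first exact: continuous_const.
  by apply: continuous_mul; [exact: continuous_const|move=> ?].
rewrite !sE ?lexx ?ler01// !cexp_natM mulr1 mulr0 cexp_period cexp0 subrr add0r.
by rewrite !mulr0 subr0 mulrC.
Qed.

Lemma circle_simplex_edge (u : R) : 0 <= u <= 1 ->
  circle_simplex R (edge u) = cexp (2 * pi * u).
Proof.
move=> u1; have e : set_val (edge u) 0 1 = u.
  rewrite -[RHS](coord_edge u1) /coord; congr (set_val (edge u) 0 _).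
  by apply: val_inj; rewrite /= inordK.
by apply: circle_val_inj; rewrite /= /circle_turn e.
Qed.

Definition circle_pow (m : nat) : continuousType (circle R) (circle R) :=
  continuous_map (@continuous_circle_expg R _ idfun m (fun x => @cvg_id _ (nbhs x))).

Lemma winding_circle_pow m :
  winding_class (H1_push (circle_pow m) (circle_class R A)) = m%:R.
Proof.
rewrite /circle_class H1_pushE winding_classE /= push_chainU winding_chainU.
rewrite (@simplex_winding_loop _ m)// => u u1.
rewrite cexp_natM -circle_simplex_edge//.
Qed.

Lemma winding_circle : winding_class (circle_class R A) = 1.
Proof.
rewrite winding_classE /= winding_chainU (@simplex_winding_loop _ 1)// => u u1.
by rewrite mul1r circle_simplex_edge.
Qed.

End WindingClass.

(** * The solid torus *)

Section Bounding.
Context (R : realType) (A : nzRingType) (X : topologicalType).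
Implicit Types c d : chain R A 1 X.

Definition bounds c := exists b, boundary R A X 1 b = c.

Lemma bounds0 : bounds 0. Proof. by exists 0; rewrite linear0. Qed.
Lemma boundsD c d : bounds c -> bounds d -> bounds (c + d).
Proof. by move=> [b <-] [b' <-]; exists (b + b'); rewrite linearD. Qed.
Lemma boundsN c : bounds c -> bounds (- c).
Proof. by move=> [b <-]; exists (- b); rewrite linearN. Qed.
Lemma boundsZ a c : bounds c -> bounds (a *: c).
Proof. by move=> [b <-]; exists (a *: b); rewrite linearZ. Qed.

(** The relation is on arbitrary chains: a single [ray] or edge is in general not a cycle, and only
    their combinations are. *)
Definition homologous c d := bounds (c - d).

Lemma homologous_refl c : homologous c c.
Proof. by rewrite /homologous subrr; exact: bounds0. Qed.
Lemma homologous_sym c d : homologous c d -> homologous d c.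
Proof. by move/boundsN; rewrite opprB. Qed.
Lemma homologous_trans d c e : homologous c d -> homologous d e -> homologous c e.
Proof. by move=> cd de; have := boundsD cd de; rewrite addrA subrK. Qed.
Lemma homologousD c d c' d' :
  homologous c d -> homologous c' d' -> homologous (c + c') (d + d').
Proof. by move=> cd cd'; have := boundsD cd cd'; rewrite addrACA -opprD. Qed.
Lemma homologousZ a c d : homologous c d -> homologous (a *: c) (a *: d).
Proof. by move=> cd; have := boundsZ a cd; rewrite scalerBr. Qed.

Lemma chain_ind (P : chain R A 1 X -> Prop) : P 0 ->
  (forall c d, P c -> P d -> P (c + d)) -> (forall a c, P c -> P (a *: c)) ->
  (forall s, P << s >>) -> forall c, P c.
Proof.
move=> P0 PD PZ PU c; rewrite -[c]freeg_sumE.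
elim: (dom c) => [|s r IHr]; first by rewrite big_nil.
rewrite big_cons; apply: PD => //.
suff -> : << coeff s c *g s >> = coeff s c *: << s >> :> {freeg _ / A} by exact: PZ.
by apply/eqP/freeg_eqP => t; rewrite coeffZ !coeffU mul1r.
Qed.

(* The square with its vertical sides identified is cut into two triangles
   along the diagonal. *)
Lemma loop_homotopy (H : R * R -> X) (p q : simplex R 1 X) : continuous H ->
  (forall v, H (0, v) = H (1, v)) ->
  (forall u, 0 <= u <= 1 -> p (edge u) = H (u, 0)) ->
  (forall u, 0 <= u <= 1 -> q (edge u) = H (u, 1)) ->
  homologous << p >> << q >>.
Proof.
move=> Hc H01 pH qH.
have f1 : continuous (fun t : R * R => t.1) by move=> t; exact: cvg_fst.
have f2 : continuous (fun t : R * R => t.2) by move=> t; exact: cvg_snd.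
have idc : continuous (@idfun R) by move=> ?.
have cc (x : R) : continuous (fun _ : R => x) by exact: continuous_const.
have F1c : continuous (fun t : R * R => H (t.1 + t.2, t.2)).
  by apply: continuous_compose => //; apply: pair_cts => //; exact: continuous_add.
have F2c : continuous (fun t : R * R => H (t.2, t.1 + t.2)).
  by apply: continuous_compose => //; apply: pair_cts => //; exact: continuous_add.
have sidec : continuous (fun u => H (1, u)).
  by apply: continuous_compose => //; exact: pair_cts.
have diagc : continuous (fun u => H (u, u)).
  by apply: continuous_compose => //; exact: pair_cts.
have e1 : boundary R A X 1 << triangle_simplex F1c >> =
    << path_simplex sidec >> - << path_simplex diagc >> + << p >>.
  apply: boundary_triangle => u u1; rewrite ?path_simplex_edge ?pH//=.
  - by rewrite subrK.
  - by rewrite add0r.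
  - by rewrite addr0.
have e2 : boundary R A X 1 << triangle_simplex F2c >> =
    << q >> - << path_simplex diagc >> + << path_simplex sidec >>.
  apply: boundary_triangle => u u1; rewrite ?path_simplex_edge ?qH//=.
  - by rewrite subrK.
  - by rewrite add0r.
  - by rewrite addr0 H01.
exists (<< triangle_simplex F1c >> - << triangle_simplex F2c >>).
rewrite linearB/= e1 e2 [in X in _ - X]addrC [in X in _ - X](addrC << q >>).
by rewrite addrA opprD addrACA subrr add0r.
Qed.

End Bounding.

(** * First homology of the solid torus *)

Section SolidTorusHomology.
Context (R : realType) (A : nzRingType).
Notation T := (solid_torus R).

Fact disc_scale_subproof (r : R) (z : disc R) : `|(clamp r)%:C%C * disc_val z| <= 1.
Proof.
have /andP[r0 r1] := clamp01 r.
rewrite normrM normc_def/= expr0n addr0 sqrtr_sqr ger0_norm//.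
rewrite -[leRHS]mulr1 ler_pM ?disc_norm//; first by rewrite lecR.
by rewrite -[1]/(1%:C%C) lecR.
Qed.
Definition disc_scale r z := mk_disc (disc_scale_subproof r z).

Lemma disc_re_scale r z : disc_re (disc_scale r z) = clamp r * disc_re z.
Proof.
rewrite /disc_re -[disc_val (disc_scale r z)]/((clamp r)%:C%C * disc_val z).
by case: (disc_val z) => a b /=; rewrite mul0r subr0.
Qed.
Lemma disc_im_scale r z : disc_im (disc_scale r z) = clamp r * disc_im z.
Proof.
rewrite /disc_im -[disc_val (disc_scale r z)]/((clamp r)%:C%C * disc_val z).
by case: (disc_val z) => a b /=; rewrite mul0r addr0.
Qed.

Lemma disc_eq (z w : disc R) : disc_re z = disc_re w -> disc_im z = disc_im w -> z = w.
Proof.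
move=> zw1 zw2; apply: disc_val_inj.
by apply/eqP; rewrite eq_complex; apply/andP; split; apply/eqP.
Qed.

Lemma disc_scale1 r z : 1 <= r -> disc_scale r z = z.
Proof.
by move=> r1; apply: disc_eq; rewrite (disc_re_scale, disc_im_scale) clamp_ge1// mul1r.
Qed.
Lemma disc_scale0 r z : r <= 0 -> disc_scale r z = disc_zero R.
Proof.
by move=> r0; apply: disc_eq; rewrite (disc_re_scale, disc_im_scale) clamp_le0// mul0r.
Qed.

Lemma continuous_disc_scale (X : topologicalType) (f : X -> R) (g : X -> disc R) :
  continuous f -> continuous g -> continuous (fun x => disc_scale (f x) (g x)).
Proof.
move=> fc /continuous_disc_reim[gr gi].
have cc : continuous (fun x => clamp (f x)).
  by apply: continuous_compose => //; exact: clamp_continuous.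
apply: disc_continuousP; under eq_fun do rewrite ?disc_re_scale ?disc_im_scale.
  exact: continuous_mul.
exact: continuous_mul.
Qed.

Let idc : continuous (@idfun R). Proof. by move=> ?. Qed.
Let cc (x : R) (X : topologicalType) : continuous (fun _ : X => x).
Proof. exact: continuous_const. Qed.

Definition ramp (u : R) : R := clamp (2 * u - 1).
Lemma ramp_continuous : continuous ramp.
Proof.
apply: continuous_compose; first exact: clamp_continuous.
by apply: continuous_add => //; apply: continuous_mul.
Qed.
Lemma ramp_half u : u <= 2^-1 -> ramp u = 0.
Proof. by move=> u2; rewrite /ramp clamp_le0//; lra. Qed.
Lemma ramp1 : ramp 1 = 1. Proof. by rewrite /ramp clamp_ge1//; lra. Qed.

Fact ray_continuous (z : disc R) (l : R) :
  continuous (fun u : R => (disc_scale (ramp u) z, cexp (ramp u * l)) : T).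
Proof.
apply: pair_cts.
  by apply: continuous_disc_scale; [exact: ramp_continuous|exact: continuous_const].
apply: continuous_compose; first exact: cexp_continuous.
by apply: continuous_mul => //; exact: ramp_continuous.
Qed.

(** The image in T of the segment from (0, 0) to (z, l) in the cover, at rest in the apex until time
    1/2. Since l is a real number and not an angle, rays to l and to l + 2 pi n have the same end
    point in T but differ by n turns. *)
Definition ray (z : disc R) (l : R) : simplex R 1 T :=
  path_simplex (@ray_continuous z l).

(** Equal to s for 1/2 <= s <= 3/2 and at least 1/2 everywhere, it replaces s as a denominator. For
    smaller s the cone is constant at the apex, so the altered quotient has no effect there. *)
Let pull (s : R) : R := 2^-1 + clamp (s - 2^-1).
Let pull_gt0 s : 0 < pull s.
Proof. by rewrite /pull; have /andP[] := clamp01 (s - 2^-1); lra. Qed.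

(* The cone over the lifted path [(z, l)] in the contractible cover [disc * R];
   [ramp] crushes a neighbourhood of the apex so that no continuity argument is
   needed there. *)
Lemma homologous_lifted_path (z : R -> disc R) (l : R -> R) (s : simplex R 1 T) :
  continuous z -> continuous l ->
  (forall u, 0 <= u <= 1 -> s (edge u) = (z u, cexp (l u))) ->
  homologous (<< s >> : chain R A 1 T)
    (<< ray (z 1) (l 1) >> - << ray (z 0) (l 0) >>).
Proof.
move=> zc lc sE.
have f1 : continuous (fun t : R * R => t.1) by move=> t; exact: cvg_fst.
have f2 : continuous (fun t : R * R => t.2) by move=> t; exact: cvg_snd.
have sc : continuous (fun t : R * R => t.1 + t.2) by exact: continuous_add.
have rc : continuous (fun t : R * R => ramp (t.1 + t.2)).
  by apply: continuous_compose => //; exact: ramp_continuous.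
have tc : continuous (fun t : R * R => clamp (t.2 / pull (t.1 + t.2))).
  apply: continuous_compose; first exact: clamp_continuous.
  apply: continuous_mul => //; apply: continuous_inv => [t|]; first by rewrite gt_eqF.
  apply: continuous_add => //; apply: continuous_compose; first exact: clamp_continuous.
  by apply: continuous_add.
(* Polar coordinates about the apex: t.1 + t.2 is the radius and t.2 / (t.1 + t.2) the position
   along the lifted path. *)
have Fc : continuous (fun t : R * R =>
    (disc_scale (ramp (t.1 + t.2)) (z (clamp (t.2 / pull (t.1 + t.2)))),
     cexp (ramp (t.1 + t.2) * l (clamp (t.2 / pull (t.1 + t.2))))) : T).
  apply: pair_cts.
    by apply: continuous_disc_scale => //; exact: continuous_compose.
  apply: continuous_compose; first exact: cexp_continuous.
  by apply: continuous_mul => //; exact: continuous_compose.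
exists << triangle_simplex Fc >>; rewrite opprB [_ - << ray (z 1) _ >>]addrC addrA.
apply: boundary_triangle => u u1; rewrite ?path_simplex_edge//=.
- rewrite sE// subrK ramp1 disc_scale1// mul1r.
  rewrite (_ : u / pull 1 = u) ?clamp_id//.
  by rewrite /pull clamp_id; [field|apply/andP; split; lra].
- rewrite add0r.
  have [u2|u2] := leP u 2^-1; first by rewrite ramp_half// !disc_scale0// !mul0r.
  rewrite (_ : clamp (u / pull u) = 1)// /pull (@clamp_id _ (u - _)); last first.
    by move/andP: u1 => [_ ?]; apply/andP; split; lra.
  by rewrite addrC subrK divff ?clamp_ge1// gt_eqF//; lra.
- rewrite addr0 mul0r.
  by rewrite (_ : clamp 0 = 0)// clamp_le0.
Qed.

Definition core : continuousType (circle R) T :=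
  continuous_map (@slice_cts R (disc_zero R)).
Definition core_simplex : simplex R 1 T := push_simplex core (circle_simplex R).

Lemma homologous_ray_period (z : disc R) (l : R) :
  homologous (<< ray z (l + 2 * pi) >> : chain R A 1 T)
    (<< core_simplex >> + << ray z l >>).
Proof.
have lc : continuous (fun u : R => l + 2 * pi * u).
  by apply: continuous_add => //; apply: continuous_mul.
have zc : continuous (fun _ : R => z) by exact: continuous_const.
have pc : continuous (fun u : R => (z, cexp (l + 2 * pi * u)) : T).
  apply: pair_cts => //.
  by apply: continuous_compose => //; exact: cexp_continuous.
have := @homologous_lifted_path (fun=> z) _ (path_simplex pc) zc lc.
move=> /(_ (fun u u1 => path_simplex_edge pc u1)); rewrite mulr1 mulr0 addr0 => B1.
have f1 : continuous (fun t : R * R => t.1) by move=> t; exact: cvg_fst.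
have f2 : continuous (fun t : R * R => t.2) by move=> t; exact: cvg_snd.
have Nc : continuous (fun t : R * R => 1 - t.2).
  by apply: continuous_add => //; exact: continuous_opp.
(* A homotopy of loops: z shrinks to the centre while the starting angle l decreases linearly to 0,
   which ends at the core circle. *)
have Hc : continuous (fun t : R * R =>
    (disc_scale (1 - t.2) z, cexp ((1 - t.2) * l + 2 * pi * t.1)) : T).
  apply: pair_cts; first by apply: continuous_disc_scale => //; exact: continuous_const.
  apply: continuous_compose; first exact: cexp_continuous.
  by apply: continuous_add; apply: continuous_mul.
have B2 : homologous (<< path_simplex pc >> : chain R A 1 T) << core_simplex >>.
  apply: (loop_homotopy A Hc) => [v|u u1|u u1] /=.
  - by rewrite mulr0 mulr1 addr0 cexpD cexp_period mulg1.
  - by rewrite coord_edge// subr0 mul1r disc_scale1.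
  - by rewrite subrr disc_scale0// mul0r add0r -circle_simplex_edge.
have := homologousD (homologous_trans (homologous_sym B1) B2)
  (homologous_refl << ray z l >>).
by rewrite subrK.
Qed.

Lemma homologous_ray_nat (z : disc R) (l : R) (n : nat) :
  homologous (<< ray z (l + 2 * pi * n%:R) >> : chain R A 1 T)
    (n%:R *: << core_simplex >> + << ray z l >>).
Proof.
elim: n => [|n IHn].
  by rewrite mulr0 addr0 scale0r add0r; exact: homologous_refl.
have := homologous_ray_period z (l + 2 * pi * n%:R).
rewrite (_ : l + 2 * pi * n%:R + 2 * pi = l + 2 * pi * n.+1%:R); last first.
  have -> : n.+1%:R = n%:R + 1 :> R by rewrite natr1.
  ring.
move=> /homologous_trans; apply.
have -> : n.+1%:R = 1 + n%:R :> A by rewrite nat1r.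
rewrite scalerDl scale1r -addrA.
by apply: homologousD IHn; exact: homologous_refl.
Qed.

Lemma homologous_ray_int (z : disc R) (l : R) (n : int) :
  homologous (<< ray z (l + 2 * pi * n%:~R) >> : chain R A 1 T)
    (n%:~R *: << core_simplex >> + << ray z l >>).
Proof.
case: n => n; first exact: homologous_ray_nat.
(* For a negative number of turns, start at the lower end and climb [n.+1] turns back to l. *)
have := homologous_ray_nat z (l + 2 * pi * (Negz n)%:~R) n.+1.
rewrite NegzE mulrNz mulrN subrK -pmulrn => /homologous_sym h.
have := homologousD (homologous_refl (- n.+1%:R *: << core_simplex >>)) h.
by rewrite addrA -scalerDl addNr scale0r add0r mulrNz -pmulrn.
Qed.

Lemma vertex_sum : \sum_(0 <= k < 1) (1 : R) = 1.
Proof. by rewrite big_nat1. Qed.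
Definition vertex : std_simplex R 0 :=
  @simplex_point R 0 (fun=> 1) (fun=> ler01) vertex_sum.

Definition ray_chain : {linear chain R A 0 T -> chain R A 1 T} :=
  fglift (fun s : simplex R 0 T => << ray (s vertex).1 (carg (s vertex).2) >>).

Lemma ray_chainU s : ray_chain << s >> = << ray (s vertex).1 (carg (s vertex).2) >>.
Proof. by rewrite /ray_chain/= liftU scale1r. Qed.

Fact snd_cts (X Y : topologicalType) : continuous (@snd X Y).
Proof. by move=> x; exact: cvg_snd. Qed.
Definition angle : continuousType T (circle R) :=
  continuous_map (@snd_cts (disc R) (circle R)).

(** Both sides are linear in c, so one simplex suffices. Lift its angle starting at [carg] of the
    initial point: the lift ends at [carg] of the final point plus 2 pi times the winding, and these
    extra turns split off as core circles. On a cycle the term with [ray_chain] vanishes. *)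
Lemma homologous_chain (c : chain R A 1 T) :
  homologous c (winding_chain R A (push_chain R A angle 1 c) *: << core_simplex >>
    + ray_chain (boundary R A T 0 c)).
Proof.
elim/chain_ind: c => [|c d hc hd|a c hc|s].
- by rewrite !linear0 scale0r addr0; exact: homologous_refl.
- rewrite !linearD scalerDl addrACA; exact: homologousD.
- by rewrite !linearZ/= -scalerA -scalerDr; exact: homologousZ.
have sc : continuous (fun u => s (edge u)) := @simplex_edge_continuous _ _ s.
have zc : continuous (fun u => (s (edge u)).1).
  by apply: continuous_compose => //; exact: fst_cts.
have ac : continuous (fun u => (s (edge u)).2).
  by apply: continuous_compose => //; exact: snd_cts.
have [|L [Lc Ls L0]] := @lift_path R (fun u => (s (edge u)).2) (carg (s (edge 0)).2) ac.
  by rewrite cargK.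
have sE u : 0 <= u <= 1 -> s (edge u) = ((s (edge u)).1, cexp (L u)).
  by move=> u1; rewrite Ls// -surjective_pairing.
have h := homologous_lifted_path zc Lc sE.
rewrite push_chainU winding_chainU.
have := @simplex_winding_lift R (push_simplex angle s) L (conj Lc Ls).
rewrite L0 /= => /eqP; rewrite subr_eq => /eqP L1.
move: h; rewrite L0 L1 => /homologous_trans; apply.
rewrite boundary1 linearB/= !ray_chainU/= addrA.
apply: homologousD; last exact: homologous_refl.
rewrite addrAC subrK; exact: homologous_ray_int.
Qed.

Definition core_class : H1 R A T := H1_push core (circle_class R A).

Lemma H1_solid_torus (x : H1 R A T) : x = winding_class (H1_push angle x) *: core_class.
Proof.
have [[c dc] ->] := H1_exists_cycle x.
rewrite H1_pushE winding_classE /core_class /circle_class H1_pushE /=.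
set w := winding_chain _ _ _.
rewrite /H1_class H1_scaleE.
apply/eqP/homology_classP => /=; rewrite push_chainU.
have := homologous_chain c.
by move: dc; rewrite inE => /eqP ->; rewrite linear0 addr0.
Qed.

Lemma winding_core : winding_class (H1_push angle core_class) = 1.
Proof.
rewrite (@H1_push_comp _ _ _ _ _ core angle idfun)//.
by rewrite H1_push_id// winding_circle.
Qed.

Lemma H1_circle (x : H1 R A (circle R)) : x = winding_class x *: circle_class R A.
Proof.
have cK y : H1_push angle (H1_push core y) = y :> H1 R A (circle R).
  by rewrite (@H1_push_comp _ _ _ _ _ core angle idfun)// H1_push_id.
rewrite -{1}(cK x) [H1_push core x]H1_solid_torus cK H1_pushZ.
by rewrite /core_class cK.
Qed.

End SolidTorusHomology.

(** * Compact quotients *)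

Section CompactHausdorff.

Lemma cluster_continuous (X Y : topologicalType) (f : X -> Y) (p q : X) :
  continuous f -> cluster (nbhs p) q -> cluster (nbhs (f p)) (f q).
Proof.
move=> fc pq U V /fc Up /fc Vq; have [x [Ux Vx]] := pq _ _ Up Vq.
by exists (f x).
Qed.

Lemma hausdorff_inj (X Y : topologicalType) (f : X -> Y) : continuous f ->
  injective f -> hausdorff_space Y -> hausdorff_space X.
Proof.
by move=> fc fI hY p q pq; apply: fI; apply: hY; exact: cluster_continuous pq.
Qed.

Lemma hausdorff_prod (X Y : topologicalType) :
  hausdorff_space X -> hausdorff_space Y -> hausdorff_space (X * Y)%type.
Proof.
move=> hX hY [p1 p2] [q1 q2] pq; congr pair.
  by apply: hX; have := cluster_continuous (@fst_cts X Y) pq.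
by apply: hY; have := cluster_continuous (@snd_cts X Y) pq.
Qed.

Lemma compact_image (X Y : topologicalType) (f : X -> Y) (A : set X) :
  continuous f -> compact A -> (forall y, exists2 x, A x & f x = y) ->
  compact [set: Y].
Proof.
move=> fc Ac fs; rewrite (_ : [set: Y] = f @` A).
  by apply: continuous_compact => //; exact: continuous_subspaceT.
by apply/seteqP; split => // y _; have [x Ax <-] := fs y; exists x.
Qed.

(** The map s is closed, being continuous from a compact space to a Hausdorff one; by injectivity
    the preimage of A under f is the preimage under c of the closed set s(A). *)
Lemma compact_factor_continuous (X Y Z : topologicalType) (s : X -> Z) (c : Y -> Z)
    (f : Y -> X) : compact [set: X] -> hausdorff_space Z -> continuous s ->
  injective s -> continuous c -> (forall y, s (f y) = c y) -> continuous f.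
Proof.
move=> Xc hZ sc sI cc sf; apply/continuous_closedP => A cA.
rewrite (_ : f @^-1` A = c @^-1` (s @` A)).
  apply: (continuous_closedP c).1 => //; apply: compact_closed => //.
  apply: continuous_compact; first exact: continuous_subspaceT.
  exact: subclosed_compact cA Xc _.
apply/seteqP; split => [y Ay|y [x Ax]]; first by exists (f y).
by rewrite -sf => /sI xy; rewrite /= -xy.
Qed.

Lemma compact_inverse_continuous (X Y : topologicalType) (f : X -> Y) (g : Y -> X) :
  compact [set: X] -> hausdorff_space Y -> continuous f ->
  cancel f g -> cancel g f -> continuous g.
Proof.
move=> Xc hY fc fK gK.
by apply: (compact_factor_continuous Xc hY fc (can_inj fK) (c := idfun)) => // ?.
Qed.

Lemma quotient_homeo (R : realType) (X Y : topologicalType)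
    (G : finite_circle_subgroup R) (act : circle_action R X) (f : X -> Y) :
  compact [set: X] -> hausdorff_space Y -> continuous f ->
  (forall y, exists x, f x = y) ->
  (forall x x', f x = f x' <-> exists2 a, a \in fcs_set G & act a x = x') ->
  exists (h : continuousType (orbit_space G act) Y)
    (h' : continuousType Y (orbit_space G act)),
    [/\ cancel h h', cancel h' h & forall x, h (orbit_pi G act x) = f x].
Proof.
move=> Xc hY fc fs fP.
pose h (u : orbit_space G act) := f (orbit_repr u).
have hE x : h (orbit_pi G act x) = f x.
  by apply/fP/orbit_piP; rewrite orbit_reprK.
have hc : continuous h.
  apply/(@quotient_continuous X {eq_quot orbit_equiv G act}%qT).
  by rewrite (_ : _ \o _ = f)//; apply/funext => x; exact: hE.
pose h' (y : Y) := orbit_pi G act (sval (cid (fs y))).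
have h'K : cancel h' h by move=> y; rewrite /h' hE; case: cid.
have hK : cancel h h'.
  move=> u; rewrite -[u]orbit_reprK hE /h'; apply/orbit_piP/fP.
  by case: cid.
have Qc : compact [set: orbit_space G act].
  apply: (@compact_image X _ (orbit_pi G act) [set: X]) => //; first exact: cts_fun.
  by move=> u; exists (orbit_repr u) => //; exact: orbit_reprK.
have h'c := compact_inverse_continuous Qc hY hc hK h'K.
by exists (continuous_map hc), (continuous_map h'c).
Qed.

End CompactHausdorff.

Section CircleTopology.
Context (R : realType).

Lemma circle_hausdorff : hausdorff_space (circle R).
Proof.
apply: (@hausdorff_inj _ R[i]^o (@circle_val R)).
- exact: initial_continuous.
- exact: circle_val_inj.
- exact: norm_hausdorff.
Qed.

Lemma disc_hausdorff : hausdorff_space (disc R).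
Proof.
apply: (@hausdorff_inj _ R[i]^o (@disc_val R)).
- exact: initial_continuous.
- exact: disc_val_inj.
- exact: norm_hausdorff.
Qed.

Lemma circle_compact : compact [set: circle R].
Proof.
apply: (@compact_image R _ (@cexp R) `[- pi, pi]%classic).
- exact: cexp_continuous.
- exact: segment_compact.
- by move=> x; have [t tpi tx] := cexp_surj_itv x; exists t; rewrite //= in_itv.
Qed.

Lemma disc_polar (z : disc R) : exists2 u : R * circle R,
  0 <= u.1 <= 1 & disc_scale u.1 (circle_disc u.2) = z.
Proof.
have [z0|z0] := eqVneq (disc_val z) 0.
  exists (0, 1%g); rewrite /= ?lexx ?ler01// disc_scale0//.
  by apply: disc_val_inj; rewrite z0.
pose r := Num.sqrt (disc_re z ^+ 2 + disc_im z ^+ 2).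
have rE : `|disc_val z| = r%:C%C by rewrite normc_def.
have r0 : 0 < r%:C%C :> R[i] by rewrite -rE normr_gt0.
have z1 : `|disc_val z / r%:C%C| = 1.
  by rewrite normrM normfV -rE normr_id divff// normr_eq0.
exists (r, mk_circle z1) => /=.
  by rewrite -!lecR -rE disc_norm normr_ge0.
apply: disc_val_inj; change ((clamp r)%:C%C * (disc_val z / r%:C%C) = disc_val z).
rewrite clamp_id; first by rewrite mulrC divfK// gt_eqF.
by rewrite -!lecR -rE disc_norm normr_ge0.
Qed.

Lemma disc_compact : compact [set: disc R].
Proof.
apply: (@compact_image (R * circle R)%type _ (fun u => disc_scale u.1 (circle_disc u.2))
  (`[0, 1]%classic `*` [set: circle R])).
- apply: continuous_disc_scale; first exact: fst_cts.
  by apply: continuous_compose; [exact: circle_disc_continuous|exact: snd_cts].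
- by apply: compact_setX; [exact: segment_compact|exact: circle_compact].
- by move=> z; have [u u1 uz] := disc_polar z; exists u.
Qed.

Lemma solid_torus_hausdorff : hausdorff_space (solid_torus R).
Proof. exact: hausdorff_prod disc_hausdorff circle_hausdorff. Qed.

Lemma solid_torus_compact : compact [set: solid_torus R].
Proof. by rewrite -setXTT; exact: compact_setX disc_compact circle_compact. Qed.

End CircleTopology.

(** * Powers and finite subgroups *)

Section CirclePowers.
Context (R : realType).
Implicit Types x y : circle R.

Lemma circle_val_expg x n : circle_val (x ^+ n)%g = circle_val x ^+ n.
Proof.
elim: n => [|n IHn]; first by rewrite expr0.
by rewrite expgS exprS -IHn.
Qed.

Lemma circle_exp_nat x (n : nat) : circle_exp x n = (x ^+ n)%g.
Proof. by apply: circle_val_inj; rewrite circle_val_expg. Qed.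

Lemma circle_expM x (a b : int) : circle_exp x (a * b) = circle_exp (circle_exp x a) b.
Proof. by apply: circle_val_inj; apply/esym; exact: exprz_exp. Qed.

Lemma circle_expD x (a b : int) :
  circle_exp x (a + b) = (circle_exp x a * circle_exp x b)%g.
Proof. by apply: circle_val_inj; exact: expfzDr (circle_neq0 x). Qed.

Lemma circle_expMl x y (k : int) :
  circle_exp (x * y)%g k = (circle_exp x k * circle_exp y k)%g.
Proof. by apply: circle_val_inj; exact: expfzMl. Qed.

Lemma circle_exp1n (k : int) : circle_exp 1%g k = 1%g :> circle R.
Proof. by apply: circle_val_inj; exact: exp1rz. Qed.

Lemma circle_expgMn x y n : ((x * y) ^+ n = x ^+ n * y ^+ n)%g.
Proof. by rewrite -!circle_exp_nat circle_expMl. Qed.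

Lemma circle_root x (n : nat) : (0 < n)%N -> exists y, (y ^+ n)%g = x.
Proof.
move=> n0; have [t tx] := cexp_surj x; exists (cexp (t / n%:R)).
by rewrite -cexp_natM mulrC divfK// pnatr_eq0 -lt0n.
Qed.

End CirclePowers.

Section RootsOfUnity.
Context (R : realType) (G : finite_circle_subgroup R).
Let n : nat := #|` fcs_set G|%fset.

Lemma fcs_card_gt0 : (0 < n)%N.
Proof. by rewrite cardfs_gt0; apply/fset0Pn; exists 1%g; have [] := fcs_group G. Qed.

(** Translation by x permutes G, so the product P of all elements satisfies x^n P = P. *)
Lemma fcsX x : x \in fcs_set G -> (x ^+ n = 1)%g.
Proof.
move=> Gx; have GM := group_closedM (fcs_group G).
apply: circle_val_inj; rewrite circle_val_expg.
pose P := \prod_(y <- fcs_set G) circle_val y.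
have P0 : P != 0.
  by rewrite prodf_seq_neq0; apply/allP => y _ /=; rewrite circle_neq0.
have perm : perm_eq [seq (x * y)%g | y <- fcs_set G] (fcs_set G).
  have xI : uniq [seq (x * y)%g | y <- fcs_set G].
    by rewrite map_inj_uniq ?fset_uniq//; exact: mulgI.
  have xG : {subset [seq (x * y)%g | y <- fcs_set G] <= fcs_set G}.
    by move=> _ /mapP[y Gy ->]; exact: GM.
  have [|_ xE] := uniq_min_size xI xG; first by rewrite size_map.
  exact: uniq_perm xI (fset_uniq _) xE.
have := perm_big _ perm (P := predT) (F := @circle_val R) : _ = P.
rewrite big_map big_split /= big_const_seq count_predT iter_mulr.
rewrite mulr1 => /(canRL (mulfK P0)); rewrite divff// => <-.
Qed.

(** G consists of n roots of X^n - 1, and one more root would exceed the degree. Thus G is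
    determined by its order. *)
Lemma mem_fcs x : (x \in fcs_set G) = (x ^+ n == 1)%g.
Proof.
apply/idP/eqP => [|xn]; first exact: fcsX.
apply/negP => /negP xG.
have : (size [seq circle_val y | y <- x :: fcs_set G] <= n)%N.
  apply: max_unity_roots; first exact: fcs_card_gt0.
    rewrite all_map; apply/allP => y; rewrite inE /= unity_rootE -circle_val_expg.
    by move=> /predU1P[->|/fcsX ->]; rewrite ?xn.
  by rewrite map_inj_uniq /= ?xG ?fset_uniq//; exact: circle_val_inj.
by rewrite size_map /= ltnn.
Qed.

Lemma rot_orbit x y : (x ^+ n = y ^+ n)%g <->
  exists2 a, a \in fcs_set G & rot_action R a x = y.
Proof.
split=> [xy|[a Ga <-]]; last by rewrite /= circle_expgMn (fcsX Ga) mul1g.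
exists (y * x^-1)%g; last by rewrite /= mulgVK.
by rewrite mem_fcs circle_expgMn expVgn -xy mulgV.
Qed.

End RootsOfUnity.

Section PowerOrbits.
Context (R : realType) (G : finite_circle_subgroup R) (k : int).
Let n : nat := #|` fcs_set G|%fset.
Let d : nat := gcdn `|k| n.

(** The order of the image of G under the k-th power, an image which consists of the e-th roots of
    unity. *)
Definition pow_order : nat := n %/ d.
Let e := pow_order.

Lemma pow_gcd_gt0 : (0 < d)%N.
Proof. by rewrite gcdn_gt0 fcs_card_gt0 orbT. Qed.

Lemma pow_orderM : (d * e = n)%N.
Proof. by rewrite mulnC divnK// dvdn_gcdr. Qed.

Lemma pow_order_gt0 : (0 < e)%N.
Proof. by have := fcs_card_gt0 G; rewrite -/n -pow_orderM muln_gt0 => /andP[]. Qed.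

Lemma pow_coprime : exists (k' j : int) (m : nat),
  k = d%:Z * k' /\ m%:Z * k' = e%:Z * j - 1.
Proof.
have d0 := pow_gcd_gt0; have e0 := pow_order_gt0; have de := pow_orderM.
have [u [v uv]] := Bezoutz k n%:Z.
have kd : (d%:Z %| k)%Z by rewrite dvdzE dvdn_gcdl.
move/divzK: kd; set k' := (k %/ d%:Z)%Z => kk'.
have uv' : u * k' + v * e%:Z = 1.
  apply: (@mulIf _ d%:Z); first by rewrite eqz_nat -lt0n.
  rewrite mulrDl -!mulrA kk' -PoszM [(e * d)%N]mulnC de uv mul1r.
  by rewrite /gcdz absz_nat.
(* From u k' + v e = 1 the natural choice is m = -u; adding e |u| keeps it modulo e and makes it
   nonnegative, so that it can serve as a natural exponent. *)
exists k', (v + `|u|%:Z * k'), `|(- u + e%:Z * `|u|%:Z)%R|%N.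
split; first by rewrite mulrC kk'.
rewrite gez0_abs; last by nia.
have -> : 1 = u * k' + v * e%:Z by rewrite uv'.
by ring.
Qed.

Lemma pow_order_exp a : a \in fcs_set G -> (circle_exp a k ^+ e = 1)%g.
Proof.
move=> Ga; have [k' [j [m [kE _]]]] := pow_coprime.
rewrite -circle_exp_nat -circle_expM kE mulrAC -PoszM pow_orderM circle_expM.
by rewrite circle_exp_nat fcsX// circle_exp1n.
Qed.

Lemma pow_orbit x y : (x ^+ e = y ^+ e)%g <->
  exists2 a, a \in fcs_set G & pow_action R k a x = y.
Proof.
split=> [xy|[a Ga <-]]; last by rewrite /= circle_expgMn (pow_order_exp Ga) mul1g.
have [k' [j [m [kE mE]]]] := pow_coprime.
pose w := (y * x^-1)%g.
have we : (w ^+ e = 1)%g by rewrite circle_expgMn expVgn -xy mulgV.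
(* If a^d = w^(-m), then a^n = w^(-m e) = 1 puts a in G, and a^k = w^(-m k') = w^(1 - e j) = w. *)
have [a ad] := circle_root (w ^+ m)^-1%g pow_gcd_gt0.
exists a.
  rewrite mem_fcs -/n -pow_orderM expgnA ad expVgn -expgnA mulnC.
  by rewrite expgnA we expg1n invg1.
rewrite /= kE circle_expM circle_exp_nat ad.
suff -> : circle_exp (w ^+ m)^-1%g k' = w by rewrite mulgVK.
have : (circle_exp (w ^+ m) k' * circle_exp (w ^+ m)^-1 k' = 1)%g.
  by rewrite -circle_expMl mulgV circle_exp1n.
rewrite -{1}circle_exp_nat -circle_expM mE circle_expD circle_expM.
rewrite circle_exp_nat we circle_exp1n mul1g.
have -> : circle_exp w (-1) = w^-1%g by apply: circle_val_inj; exact: exprN1.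
by move=> h; apply: (@mulgI _ w^-1%g); rewrite h mulVg.
Qed.

End PowerOrbits.

(** * The solid torus as its own quotient *)

Section TorusQuotient.
Context (R : realType).

Lemma continuous_disc_product (X : topologicalType) (f g h : X -> disc R) :
  (forall x, disc_val (h x) = disc_val (f x) * disc_val (g x)) ->
  continuous f -> continuous g -> continuous h.
Proof.
move=> hE /continuous_disc_reim[fr fi] /continuous_disc_reim[gr gi].
apply: disc_continuousP.
  rewrite (_ : (fun _ => _) =
      fun x => disc_re (f x) * disc_re (g x) - disc_im (f x) * disc_im (g x)).
    by apply: continuous_add; [|apply: continuous_opp]; apply: continuous_mul.
  by apply/funext => x; rewrite /disc_re hE complex_ReM.
rewrite (_ : (fun _ => _) =
    fun x => disc_re (f x) * disc_im (g x) + disc_im (f x) * disc_re (g x)).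
  by apply: continuous_add; apply: continuous_mul.
by apply/funext => x; rewrite /disc_im hE complex_ImM.
Qed.

Fact disc_pow_subproof (z : disc R) (d : nat) : `|disc_val z ^+ d| <= 1.
Proof. by rewrite normrX exprn_ile1 ?disc_norm. Qed.
Definition disc_pow z d : disc R := mk_disc (disc_pow_subproof z d).

Lemma continuous_disc_pow (X : topologicalType) (f : X -> disc R) d :
  continuous f -> continuous (fun x => disc_pow (f x) d).
Proof.
move=> fc; elim: d => [|d IHd].
  rewrite (_ : (fun _ => _) = fun=> disc_one R); first exact: continuous_const.
  by apply/funext => x; apply: disc_val_inj; exact: expr0.
by apply: (continuous_disc_product _ fc IHd) => x; exact: exprS.
Qed.

Lemma continuous_disc_rot (X : topologicalType) (f : X -> circle R) (g : X -> disc R) :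
  continuous f -> continuous g -> continuous (fun x => disc_rot (f x) (g x)).
Proof.
move=> fc gc; apply: (@continuous_disc_product _ (fun x => circle_disc (f x)) g) => //.
by apply: continuous_compose => //; exact: circle_disc_continuous.
Qed.

Context (G : finite_circle_subgroup R) (k : int).
Let n : nat := #|` fcs_set G|%fset.
Let d : nat := gcdn `|k| n.
Let e : nat := pow_order G k.

Definition torus_pow (m : nat) (u : solid_torus R) : solid_torus R :=
  (disc_rot (u.2 ^+ m)%g (disc_pow u.1 d), (u.2 ^+ e)%g).

Lemma torus_pow_continuous m : continuous (torus_pow m).
Proof.
have f1 : continuous (fun u : solid_torus R => u.1) by exact: fst_cts.
have f2 : continuous (fun u : solid_torus R => u.2) by exact: snd_cts.
apply: pair_cts; last exact: continuous_circle_expg.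
apply: continuous_disc_rot; first exact: continuous_circle_expg.
exact: continuous_disc_pow.
Qed.

Lemma torus_pow_surj m v : exists u, torus_pow m u = v.
Proof.
case: v => w x; have [y yx] := circle_root x (pow_order_gt0 G k).
pose z := d.-root (disc_val w / circle_val (y ^+ m)%g).
have d0 : (0 < d)%N by exact: pow_gcd_gt0.
have zd : z ^+ d = disc_val w / circle_val (y ^+ m)%g by exact: rootCK.
have z1 : `|z| <= 1.
  have : `|z| ^+ d <= 1.
    by rewrite -normrX zd normrM normfV circle_norm invr1 mulr1 disc_norm.
  by rewrite expr_le1.
exists (mk_disc z1, y); congr pair => //; apply: disc_val_inj.
change (circle_val (y ^+ m)%g * z ^+ d = disc_val w).
by rewrite zd mulrC divfK// circle_neq0.
Qed.

(** Invariance: a multiplies the first component by a^(d + k m) = 1. Conversely, equal second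
    components give a in G carrying x to y, and then (a z)^d = w^d. For w = 0 this a suffices;
    otherwise it is corrected by b = w / (a z), a d-th root of unity, which lies in G and satisfies
    b^k = 1, hence leaves y fixed. *)
Lemma torus_pow_orbit : exists m, forall u v, torus_pow m u = torus_pow m v <->
  exists2 a, a \in fcs_set G & solid_torus_action R k a u = v.
Proof.
have [k' [j [m [kE mE]]]] := pow_coprime G k; exists m => -[z x] [w y].
have d0 : (0 < d)%N by exact: pow_gcd_gt0.
(* d + k m = d e j *)
have inv a t : a \in fcs_set G ->
    circle_val ((circle_exp a k * x) ^+ m)%g * (circle_val a * t) ^+ d =
    circle_val (x ^+ m)%g * t ^+ d.
  move=> Ga; have ak : (circle_exp a k ^+ m * a ^+ d = 1)%g.
    rewrite circle_mulC -!circle_exp_nat -circle_expM -circle_expD kE.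
    rewrite -mulrA [k' * _]mulrC mE mulrBr mulr1 addrC subrK mulrA -PoszM.
    by rewrite /d /e pow_orderM circle_expM circle_exp_nat fcsX// circle_exp1n.
  rewrite circle_expgMn exprMn -circle_val_expg.
  rewrite -[circle_val (_ * x ^+ m)%g]/(circle_val _ * circle_val _) mulrACA.
  rewrite -[X in X * _](congr1 (@circle_val R) (erefl (circle_exp a k ^+ m * a ^+ d)%g)).
  by rewrite ak mul1r.
split=> [[] h xy|[a Ga [<- <-]]]; last first.
  congr pair; last by rewrite /= circle_expgMn (pow_order_exp k Ga) mul1g.
  by apply: disc_val_inj; apply/esym; exact: inv.
have {}h : circle_val (x ^+ m)%g * disc_val z ^+ d =
    circle_val (y ^+ m)%g * disc_val w ^+ d by exact: h.
have [a Ga axy] := (pow_orbit G k x y).1 xy.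
have aw : (circle_val a * disc_val z) ^+ d = disc_val w ^+ d.
  by apply: (mulfI (circle_neq0 (y ^+ m)%g)); rewrite -h -axy; exact: inv.
have [w0|w0] := eqVneq (disc_val w) 0.
  exists a => //; congr pair => //; apply: disc_val_inj.
  move: aw; rewrite w0 expr0n gtn_eqF// => /eqP; rewrite expf_eq0 => /andP[_ /eqP aw].
  exact: aw.
have az0 : circle_val a * disc_val z != 0.
  apply: contraNneq w0 => az; move: aw; rewrite az expr0n gtn_eqF//.
  by move=> /esym/eqP; rewrite expf_eq0 => /andP[].
have b1 : `|disc_val w / (circle_val a * disc_val z)| = 1.
  apply/eqP; rewrite -(@pexpr_eq1 _ _ d)// -normrX expr_div_n -aw divff ?normr1//.
  by rewrite expf_neq0.
pose b := mk_circle b1.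
have bd : (b ^+ d = 1)%g.
  apply: circle_val_inj; rewrite circle_val_expg.
  change ((disc_val w / (circle_val a * disc_val z)) ^+ d = 1).
  by rewrite expr_div_n -aw divff// expf_neq0.
exists (b * a)%g.
  rewrite mem_fcs circle_expgMn (fcsX Ga) mulg1 -(pow_orderM G k) expgnA.
  by rewrite -/d bd expg1n.
congr pair.
  apply: disc_val_inj.
  change (disc_val w / (circle_val a * disc_val z) * circle_val a * disc_val z =
    disc_val w).
  by rewrite -mulrA divfK.
rewrite -axy /= circle_expMl {1}kE circle_expM circle_exp_nat -/d bd.
by rewrite circle_exp1n mul1g.
Qed.

End TorusQuotient.

Section SubgroupIndex.
Context (R : realType) (G H : finite_circle_subgroup R).
Hypothesis HG : (fcs_set H `<=` fcs_set G)%fset.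

Lemma subgroup_indexM :
  #|` fcs_set G|%fset = (subgroup_index G H * #|` fcs_set H|%fset)%N.
Proof.
have [H1 _] := fcs_group H; have HM := group_closedM (fcs_group H).
have HV := group_closedV (fcs_group H); have GM := group_closedM (fcs_group G).
pose C x := [fset (x * y)%g | y in fcs_set H]%fset.
rewrite card_fset_sum1 (partition_big_imfset _ C) /= /subgroup_index -/C.
rewrite card_fset_sum1 big_distrl /=; apply: eq_big_seq => _ /imfsetP[/= x Gx ->].
rewrite mul1n -big_filter sum1_size.
rewrite -(size_map (fun y => x * y)%g (fcs_set H)); apply: perm_size.
apply: uniq_perm; first by rewrite filter_uniq// fset_uniq.
  by rewrite map_inj_uniq ?fset_uniq//; exact: mulgI.
move=> z; rewrite mem_filter; apply/andP/mapP => [[/eqP zx Gz]|[y Hy ->]].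
  have : z \in C z by apply/imfsetP; exists 1%g; rewrite ?mulg1.
  by rewrite zx => /imfsetP[/= y Hy zE]; exists y.
split; last by apply: GM => //; exact: (fsubsetP HG).
apply/eqP/fsetP => t; apply/imfsetP/imfsetP => /= -[s Hs ->].
  by exists (y * s)%g; [exact: HM|rewrite mulgA].
exists (y^-1 * s)%g; first by apply: HM => //; exact: HV.
by rewrite mulgA mulgK.
Qed.

End SubgroupIndex.

(** * Degrees and fibers *)

Section Degree.
Context (R : realType).

Definition degree (f : continuousType (circle R) (circle R)) : rat :=
  winding_class (H1_push f (circle_class R rat)).

Lemma degree_ext (f g : continuousType (circle R) (circle R)) :
  f =1 g -> degree f = degree g.
Proof. by move=> /continuousEP ->. Qed.

(** On the free module of rank one H_1(S^1; Q), the map induced by g is multiplication by its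
    degree. *)
Lemma degree_comp (f g h : continuousType (circle R) (circle R)) :
  (forall x, g (f x) = h x) -> degree h = degree f * degree g.
Proof.
move=> gf; rewrite /degree -(H1_push_comp (f := f) (g := g))//.
by rewrite {1}[H1_push f _]H1_circle H1_pushZ winding_classZ.
Qed.

Lemma degree_id (f : continuousType (circle R) (circle R)) :
  (forall x, f x = x) -> degree f = 1.
Proof. by move=> fid; rewrite /degree H1_push_id// winding_circle. Qed.

Lemma degree_pow m : degree (circle_pow R m) = m%:R.
Proof. exact: winding_circle_pow. Qed.

Lemma degree_bijective (f : continuousType (circle R) (circle R)) :
  bijective f -> degree f != 0.
Proof.
move=> [g fK gK].
have gc := compact_inverse_continuous (@circle_compact R) (@circle_hausdorff R)
  cts_fun fK gK.
have : degree f * degree (continuous_map gc) = 1.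
  by rewrite -(@degree_comp f (continuous_map gc) idfun)// degree_id.
by apply: contra_eq_neq => ->; rewrite mul0r eq_sym oner_neq0.
Qed.

End Degree.

Section AngularCoordinate.
Context (R : realType) (X : topologicalType) (P : continuousType X (circle R)).

(** Says that the winding of the image under [P] is an isomorphism from H_1(X; A) to A; the class c
    is the preimage of 1. *)
Definition angular (A : nzRingType) := exists c : H1 R A X,
  winding_class (H1_push P c) = 1 /\ forall x, x = winding_class (H1_push P x) *: c.

Hypothesis PA : angular rat.

Lemma angular_inj (x y : H1 R rat X) :
  winding_class (H1_push P x) = winding_class (H1_push P y) -> x = y.
Proof. by have [c [_ cE]] := PA => xy; rewrite [x]cE xy -cE. Qed.

Lemma angular_generator (x : H1 R rat X) :
  winding_class (H1_push P x) != 0 -> H1_generator x.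
Proof.
move=> x0; pose w (y : H1 R rat X) := winding_class (H1_push P y).
exists (fun y => w y / w x) => [a|y].
  by rewrite /w H1_pushZ winding_classZ mulfK.
by apply: angular_inj; rewrite H1_pushZ winding_classZ divfK.
Qed.

Lemma winding_loop_class (c : continuousType (circle R) X) :
  winding_class (H1_push P (loop_class c)) = degree (P \o c).
Proof. by rewrite /loop_class (H1_push_comp (h := P \o c)). Qed.

End AngularCoordinate.

(** * Fundamental classes of quotient circles *)

Section FundamentalClass.
Context (R : realType) (C : topologicalType) (q : continuousType (circle R) C).
Context (h : continuousType C (circle R)) (h' : continuousType (circle R) C).
Hypotheses (hK : cancel h h') (h'K : cancel h' h).
Context (N : nat) (N0 : (0 < N)%N).
Hypothesis hq : forall x, h (q x) = (x ^+ N)%g.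

(** A generator is an integer unit times u0. As h o q is a positive power, q sends the standard
    class to a positive multiple of u0, so the sign condition leaves only u0. *)
Lemma fundamental_classE : fundamental_class q = H1_push h' (circle_class R int).
Proof.
set u0 := H1_push h' _.
have hh' x : H1_push h (H1_push h' x) = x :> H1 R int _.
  by rewrite (H1_push_comp (h := idfun))// H1_push_id.
have h'h x : H1_push h' (H1_push h x) = x :> H1 R int _.
  by rewrite (H1_push_comp (h := idfun))// H1_push_id.
have dec x : x = winding_class (H1_push h x) *: u0.
  by rewrite -[LHS]h'h [H1_push h x]H1_circle H1_pushZ -H1_circle.
have wq : winding_class (H1_push h (H1_push q (circle_class R int))) = N%:R.
  by rewrite (H1_push_comp (h := circle_pow R N))// winding_circle_pow.
have w0 : winding_class (H1_push h u0) = 1 by rewrite hh' winding_circle.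
rewrite /fundamental_class.
case: xgetP => [u _ [[b ub bu] [m m0 qm]]|/(_ u0) []]; last first.
  split; last by exists N => //; rewrite [LHS]dec wq scaler_nat.
  exists (fun x => winding_class (H1_push h x)) => [a|x] /=.
    by rewrite H1_pushZ winding_classZ w0 mulr1.
  by rewrite -dec.
rewrite [u]dec; set w := winding_class _.
have wm : w * m%:Z = N%:Z.
  by rewrite -[N%:Z]natz -wq qm -scaler_nat H1_pushZ winding_classZ mulrC natz.
(* Since u generates, u0 is a multiple of it; hence w is invertible in the integers. *)
have bw : b u0 * w = 1 by rewrite -w0 -[in RHS](bu u0) H1_pushZ winding_classZ.
have wpos : 0 < w by nia.
have bpos : 0 < b u0 by nia.
have -> : w = 1 by nia.
by rewrite scale1r.
Qed.

Lemma extend_fundamental_class :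
  H1_extend rat (fundamental_class q) = H1_push h' (circle_class R rat).
Proof. by rewrite fundamental_classE -H1_push_extend H1_extend_circle. Qed.

End FundamentalClass.

(** Turns a curve on a quotient circle into a loop on the standard circle, to which degrees
    apply. *)
Lemma orbit_loop_classE (R : realType) (X : topologicalType)
    (G : finite_circle_subgroup R) (act : circle_action R (circle R))
    (c : continuousType (orbit_space G act) X)
    (h : continuousType (orbit_space G act) (circle R))
    (h' : continuousType (circle R) (orbit_space G act)) (N : nat) :
  (0 < N)%N -> cancel h h' -> cancel h' h ->
  (forall x, h (orbit_pi G act x) = (x ^+ N)%g) ->
  orbit_loop_class c = loop_class (c \o h').
Proof.
move=> N0 hK h'K hE; rewrite /orbit_loop_class.
by rewrite (extend_fundamental_class hK h'K N0 hE); exact: H1_push_comp.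
Qed.

Section Quotients.
Context (R : realType) (k : int).
Implicit Types G : finite_circle_subgroup R.

Lemma rot_quotient G :
  exists (h : continuousType (orbit_space G (rot_action R)) (circle R))
    (h' : continuousType (circle R) (orbit_space G (rot_action R))),
  [/\ cancel h h', cancel h' h &
    forall x, h (orbit_pi G (rot_action R) x) = (x ^+ #|` fcs_set G|%fset)%g].
Proof.
apply: quotient_homeo.
- exact: circle_compact.
- exact: circle_hausdorff.
- exact: (@cts_fun _ _ (circle_pow R _)).
- by move=> y; apply: circle_root; exact: fcs_card_gt0.
- exact: rot_orbit.
Qed.

Lemma pow_quotient G :
  exists (h : continuousType (orbit_space G (pow_action R k)) (circle R))
    (h' : continuousType (circle R) (orbit_space G (pow_action R k))),
  [/\ cancel h h', cancel h' h &
    forall x, h (orbit_pi G (pow_action R k) x) = (x ^+ pow_order G k)%g].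
Proof.
apply: quotient_homeo.
- exact: circle_compact.
- exact: circle_hausdorff.
- exact: (@cts_fun _ _ (circle_pow R _)).
- by move=> y; apply: circle_root; exact: pow_order_gt0.
- exact: pow_orbit.
Qed.

Lemma torus_quotient G :
  exists (h : continuousType (orbit_space G (solid_torus_action R k)) (solid_torus R))
    (h' : continuousType (solid_torus R) (orbit_space G (solid_torus_action R k))),
  [/\ cancel h h', cancel h' h &
    forall z x, (h (orbit_pi G (solid_torus_action R k) (z, x))).2 =
      (x ^+ pow_order G k)%g].
Proof.
have [m mP] := torus_pow_orbit G k.
have [|||||h [h' [hK h'K hE]]] :=
  @quotient_homeo R _ _ G (solid_torus_action R k) (torus_pow G k m).
- exact: solid_torus_compact.
- exact: solid_torus_hausdorff.
- exact: torus_pow_continuous.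
- exact: torus_pow_surj.
- exact: mP.
- by exists h, h'; split=> // z x; rewrite hE.
Qed.

Lemma torus_quotient_hausdorff G :
  hausdorff_space (orbit_space G (solid_torus_action R k)).
Proof.
have [h [h' [hK _ _]]] := torus_quotient G.
exact: (hausdorff_inj (@cts_fun _ _ h) (can_inj hK) (@solid_torus_hausdorff R)).
Qed.

Lemma quotient_angle G :
  exists2 P : continuousType (orbit_space G (solid_torus_action R k)) (circle R),
    forall z x, P (orbit_pi G (solid_torus_action R k) (z, x)) =
      (x ^+ pow_order G k)%g &
    angular P rat.
Proof.
have [h [h' [hK h'K hE]]] := torus_quotient G.
exists (angle R \o h) => [z x|]; first exact: hE.
exists (H1_push h' (core_class R rat)); split=> [|x].
  rewrite -(H1_push_comp (f := h) (g := angle R))//.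
  rewrite [X in H1_push (angle R) X](H1_push_comp (h := idfun))//.
  by rewrite (@H1_push_id _ _ _ idfun)// winding_core.
rewrite -H1_pushZ -(H1_push_comp (f := h) (g := angle R))// -H1_solid_torus.
by rewrite (H1_push_comp (h := idfun))// H1_push_id.
Qed.

End Quotients.

(** * The fibers of the projection and their degrees *)

Section Fibers.
Context (R : realType) (k : int) (G : finite_circle_subgroup R).
Let T := orbit_space G (solid_torus_action R k).
Let pr : continuousType (solid_torus R) T := orbit_pi G (solid_torus_action R k).
Let prd : continuousType (disc R) _ := orbit_pi G (disc_action R).
Context (P : continuousType T (circle R)).
Hypothesis PE : forall z x, P (pr (z, x)) = (x ^+ pow_order G k)%g.
Hypothesis PA : angular P rat.

Lemma zetaE z x : zeta k G (pr (z, x)) = prd z.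
Proof. exact: orbit_mapE. Qed.

Lemma zeta_fiber z (u : T) : zeta k G u = prd z <-> exists x, u = pr (z, x).
Proof.
split=> [|[x ->]]; last exact: zetaE.
rewrite -[u]orbit_reprK; case: (orbit_repr u) => z' x; rewrite zetaE.
move=> /orbit_piP[a Ga az]; exists (circle_exp a k * x)%g.
by apply/orbit_piP; exists a => //; rewrite -az.
Qed.

(** Off the centre of the disc the rotation action is free, so no two points of the slice are
    identified. *)
Lemma fiber_inj z : disc_val z != 0 -> injective (fun x => pr (z, x)).
Proof.
move=> z0 x y /orbit_piP[a Ga []] az axy; rewrite -axy.
have -> : a = 1%g; last by rewrite circle_exp1n mul1g.
apply: circle_val_inj; apply: (mulIf z0).
by rewrite [RHS]mul1r; exact: (congr1 (@disc_val R) az).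
Qed.

Lemma central_fiber x y : pr (disc_zero R, x) = pr (disc_zero R, y) <->
  (x ^+ pow_order G k = y ^+ pow_order G k)%g.
Proof.
rewrite (pow_orbit G k).
split=> [/orbit_piP[a Ga [_ axy]]|[a Ga axy]]; first by exists a.
apply/orbit_piP; exists a => //; congr pair => //.
by apply: disc_val_inj; exact: mulr0.
Qed.

(** Over the centre the fiber is the quotient circle, itself homeomorphic to a circle; elsewhere a
    slice of T embeds. *)
Lemma fiber_exists b : exists c : continuousType (circle R) T,
  parameterizes c (zeta k G @^-1` [set b]).
Proof.
pose z := orbit_repr b; have bz : b = prd z by rewrite /prd orbit_reprK.
have [/(@disc_val_inj R _ (disc_zero R)) z0|z0] := eqVneq (disc_val z) 0.
  have [h [h' [hK h'K hE]]] := pow_quotient k G.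
  have fE y : exists2 x, (x ^+ pow_order G k)%g = y &
      fiber_zero k G (h' y) = pr (disc_zero R, x).
    have [x xy] := circle_root y (pow_order_gt0 G k); exists x => //.
    by rewrite -xy -hE hK; exact: orbit_mapE.
  exists (fiber_zero k G \o h'); split.
    move=> y y'; change (fiber_zero k G (h' y) = fiber_zero k G (h' y') -> y = y').
    have [x <- ->] := fE y; have [x' <- ->] := fE y'.
    by move=> /central_fiber.
  apply/seteqP; split=> [_ [y _ <-]|u].
    change (zeta k G (fiber_zero k G (h' y)) = b).
    by have [x _ ->] := fE y; rewrite bz z0; exact: zetaE.
  rewrite /= bz z0 => /zeta_fiber[x ->]; exists (x ^+ pow_order G k)%g => //.
  change (fiber_zero k G (h' (x ^+ pow_order G k)%g) = pr (disc_zero R, x)).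
  by have [x' xx' ->] := fE (x ^+ pow_order G k)%g; apply/central_fiber.
exists (pr \o continuous_map (@slice_cts R z)); split.
  by move=> x y /= /(fiber_inj z0).
apply/seteqP; split=> [_ [y _ <-]|u] /=; first by rewrite bz; exact: zetaE.
by rewrite bz => /zeta_fiber[x ->]; exists x.
Qed.

(** On the central fiber P is injective, so P o c is a bijection of the circle. On any other fiber c
    is a slice composed with a bijection f of the circle, and P o c = f^e. *)
Lemma fiber_degree b (c : continuousType (circle R) T) :
  parameterizes c (zeta k G @^-1` [set b]) -> degree (P \o c) != 0.
Proof.
move=> [cI crange].
pose z := orbit_repr b; have bz : b = prd z by rewrite /prd orbit_reprK.
have cE y : exists x, c y = pr (z, x).
  have : range c (c y) by exists y.
  by rewrite crange /= bz => /zeta_fiber.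
have cs x : exists y, c y = pr (z, x).
  have : range c (pr (z, x)) by rewrite crange /= bz; exact: zetaE.
  by move=> [y _ yx]; exists y.
have [/(@disc_val_inj R _ (disc_zero R)) z0|z0] := eqVneq (disc_val z) 0.
  apply: degree_bijective; rewrite z0 in cE cs.
  have PcI : injective (P \o c).
    move=> y y' /=; have [x cy] := cE y; have [x' cy'] := cE y'.
    rewrite cy cy' !PE => /central_fiber xx'; apply: cI.
    by rewrite cy xx' -cy'.
  have Pcs y : exists x, (P \o c) x = y.
    have [x xy] := circle_root y (pow_order_gt0 G k).
    by have [w cw] := cs x; exists w; rewrite /= cw PE.
  exists (fun y => sval (cid (Pcs y))) => [x|y]; case: cid => //= w.
  exact: PcI.
pose f y := sval (cid (cE y)).
have fE y : pr (z, f y) = c y by rewrite /f; case: cid.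
(* The slice is an injective continuous map from a compact space to a Hausdorff one, so the
   coordinate of c along it is continuous. *)
have fc : continuous f.
  apply: (compact_factor_continuous (@circle_compact R) (@torus_quotient_hausdorff R k G)
    (@cts_fun _ _ (pr \o continuous_map (@slice_cts R z))) _ (@cts_fun _ _ c) fE).
  exact: fiber_inj.
have fI : injective f by move=> y y' ff; apply: cI; rewrite -!fE ff.
have fs x : exists y, f y = x.
  by have [y cy] := cs x; exists y; apply: (fiber_inj z0); rewrite fE.
have fb : bijective f.
  by exists (fun y => sval (cid (fs y))) => [x|y]; case: cid => //= w /fI.
rewrite (@degree_comp _ (continuous_map fc) (circle_pow R (pow_order G k))).
  rewrite mulf_neq0//; first exact: degree_bijective.
  by rewrite degree_pow pnatr_eq0 -lt0n pow_order_gt0.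
by move=> y /=; rewrite -fE PE.
Qed.

Lemma fiber_loop_generator b (c : continuousType (circle R) T) :
  parameterizes c (zeta k G @^-1` [set b]) -> H1_generator (loop_class c).
Proof.
move=> cb; apply: (angular_generator PA).
by rewrite winding_loop_class (fiber_degree cb).
Qed.

Lemma fiber_orbit_loop_generator b
    (c : continuousType (orbit_space G (pow_action R k)) T) :
  parameterizes c (zeta k G @^-1` [set b]) -> H1_generator (orbit_loop_class c).
Proof.
have [h [h' [hK h'K hE]]] := pow_quotient k G.
rewrite (orbit_loop_classE c (pow_order_gt0 G k) hK h'K hE) => -[cI crange].
apply: (@fiber_loop_generator b); split.
  by move=> x y /= /cI/(can_inj h'K).
rewrite -crange; apply/seteqP; split=> [_ [x _ <-]|_ [u _ <-]]; first by exists (h' x).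
by exists (h u) => //=; rewrite hK.
Qed.

Lemma winding_fiber_one :
  winding_class (H1_push P (loop_class (fiber_one k G))) = (pow_order G k)%:R.
Proof.
rewrite winding_loop_class -(degree_pow R); apply: degree_ext => x /=.
exact: PE.
Qed.

Lemma winding_fiber_zero :
  winding_class (H1_push P (orbit_loop_class (fiber_zero k G))) = 1.
Proof.
have [h [h' [hK h'K hE]]] := pow_quotient k G.
rewrite (orbit_loop_classE _ (pow_order_gt0 G k) hK h'K hE).
rewrite winding_loop_class degree_id// => y.
have [x <-] := circle_root y (pow_order_gt0 G k).
change (P (fiber_zero k G (h' (x ^+ pow_order G k)%g)) = (x ^+ pow_order G k)%g).
by rewrite -{1}hE hK -(PE (disc_zero R)); congr (P _); exact: orbit_mapE.
Qed.

Lemma fiber_one_zero : loop_class (fiber_one k G) =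
  ((#|` fcs_set G|%fset)%:R / (gcdz k (#|` fcs_set G|%fset)%:Z)%:~R : rat) *:
    orbit_loop_class (fiber_zero k G).
Proof.
apply: (angular_inj PA); rewrite H1_pushZ winding_classZ.
rewrite winding_fiber_one winding_fiber_zero mulr1.
rewrite -{1}(pow_orderM G k) /gcdz absz_nat natrM -pmulrn mulrAC divff ?mul1r//.
by rewrite pnatr_eq0 -lt0n pow_gcd_gt0.
Qed.

End Fibers.

(** The k-th powers of H form a subgroup of those of G. Arithmetically, n_H divides n_G = d_G e_G,
    hence k e_G; dividing by d_H, e_H divides (k / d_H) e_G and is coprime to k / d_H. *)
Lemma pow_order_dvd (R : realType) (k : int) (G H : finite_circle_subgroup R) :
  (fcs_set H `<=` fcs_set G)%fset -> (pow_order H k %| pow_order G k)%N.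
Proof.
move=> HG; have := subgroup_indexM HG.
have := pow_orderM G k; have := pow_orderM H k.
have dH0 := pow_gcd_gt0 H k.
rewrite -/(pow_order H k) -/(pow_order G k).
set nG := #|` fcs_set G|%fset; set nH := #|` fcs_set H|%fset.
set eH := pow_order H k; set eG := pow_order G k => nHE nGE idx.
have [kH kHE] : exists kH, `|k|%N = (kH * gcdn `|k| nH)%N by apply/dvdnP/dvdn_gcdl.
have cop : coprime eH kH.
  rewrite coprime_sym /coprime -(eqn_pmul2l dH0) muln1 muln_gcdr.
  by rewrite [(_ * kH)%N]mulnC -kHE nHE.
rewrite -(Gauss_dvdr _ cop) -(dvdn_pmul2l dH0) nHE mulnA [(_ * kH)%N]mulnC -kHE.
apply: (@dvdn_trans nG); first by rewrite idx dvdn_mull.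
by rewrite -nGE dvdn_mul// dvdn_gcdl.
Qed.

Lemma orbit_quoE (R : realType) (X : topologicalType) (act : circle_action R X)
    (G H : finite_circle_subgroup R) (HG : (fcs_set H `<=` fcs_set G)%fset) x :
  orbit_quo act HG (orbit_pi H act x) = orbit_pi G act x.
Proof. exact: orbit_mapE. Qed.

(** In angular degrees both equations are between rational numbers, and the first is r times the
    second. *)
Lemma angular_transfer (R : realType) (X Y : topologicalType)
    (P : continuousType X (circle R)) (Q : continuousType Y (circle R))
    (i q r : rat) (s t : H1 R rat X) (s' t' : H1 R rat Y) :
  angular P rat -> angular Q rat -> r != 0 ->
  i * winding_class (H1_push P t) = winding_class (H1_push Q t') * r ->
  winding_class (H1_push P s) = r * winding_class (H1_push Q s') ->
  i *: t = q *: s <-> t' = q *: s'.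
Proof.
move=> PA QA r0 tt' ss'; split=> E; [apply: (angular_inj QA)|apply: (angular_inj PA)].
  have /(congr1 (fun x => winding_class (H1_push P x))) := E.
  rewrite !H1_pushZ !winding_classZ tt' ss' => {}E.
  by apply: (mulIf r0); rewrite E [r * _]mulrC mulrA.
rewrite !H1_pushZ !winding_classZ tt' E H1_pushZ winding_classZ ss'.
by rewrite -mulrA [r * _]mulrC.
Qed.

Theorem lemma20 (R : realType) (Gamma1 Gamma2 : finite_circle_subgroup R)
  (Gamma21 : (fcs_set Gamma2 `<=` fcs_set Gamma1)%fset) (k : int)
  (sigma1 : continuousType (orbit_space Gamma1 (rot_action R))
                           (orbit_space Gamma1 (torus_action R k)))
  (sigma2 : continuousType (orbit_space Gamma2 (rot_action R))
                           (orbit_space Gamma2 (torus_action R k)))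
  (sigma1_section : forall b, zeta_bd k Gamma1 (sigma1 b) = b)
  (sigma2_section : forall b, zeta_bd k Gamma2 (sigma2 b) = b)
  (sigma12 : forall b : orbit_space Gamma2 (rot_action R),
     orbit_quo (solid_torus_action R k) Gamma21 (torus_incl k Gamma2 (sigma2 b)) =
     torus_incl k Gamma1 (sigma1 (orbit_quo (rot_action R) Gamma21 b))) :
  [/\ forall Gamma, Gamma = Gamma1 \/ Gamma = Gamma2 ->
        homeomorphic (orbit_space Gamma (solid_torus_action R k))
                     (solid_torus R) /\
        forall b : orbit_space Gamma (disc_action R),
          [/\ exists c : continuousType (circle R) _,
                parameterizes c (zeta k Gamma @^-1` [set b]),
              forall c : continuousType (circle R) _,
                parameterizes c (zeta k Gamma @^-1` [set b]) ->
                H1_generator (loop_class c) &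
              forall c : continuousType (orbit_space Gamma (pow_action R k)) _,
                parameterizes c (zeta k Gamma @^-1` [set b]) ->
                H1_generator (orbit_loop_class c)],
      forall Gamma, Gamma = Gamma1 \/ Gamma = Gamma2 ->
        loop_class (fiber_one k Gamma) =
        ((#|` fcs_set Gamma|%fset)%:R /
         (gcdz k (#|` fcs_set Gamma|%fset)%:Z)%:~R : rat) *:
          orbit_loop_class (fiber_zero k Gamma) &
      forall q : rat,
        (subgroup_index Gamma1 Gamma2)%:R *:
          orbit_loop_class (torus_incl k Gamma1 \o sigma1) =
        q *: loop_class (fiber_one k Gamma1) <->
        orbit_loop_class (torus_incl k Gamma2 \o sigma2) =
        q *: loop_class (fiber_one k Gamma2)].

Proof.
split.
- move=> G _; split.
    by have [h [h' [hK h'K _]]] := torus_quotient k G; exists h, h'.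
  have [P PE PA] := quotient_angle k G => b; split.
  + exact: fiber_exists.
  + exact: fiber_loop_generator.
  + exact: fiber_orbit_loop_generator.
- move=> G _; have [P PE PA] := quotient_angle k G; exact: fiber_one_zero.
move=> q.
have [P1 P1E P1A] := quotient_angle k Gamma1.
have [P2 P2E P2A] := quotient_angle k Gamma2.
have [h1 [h1' [h1K h1'K h1E]]] := rot_quotient Gamma1.
have [h2 [h2' [h2K h2'K h2E]]] := rot_quotient Gamma2.
pose c1 : continuousType (circle R) _ := (torus_incl k Gamma1 \o sigma1) \o h1'.
pose c2 : continuousType (circle R) _ := (torus_incl k Gamma2 \o sigma2) \o h2'.
have o1 : winding_class (H1_push P1 (orbit_loop_class (torus_incl k Gamma1 \o sigma1))) =
    degree (P1 \o c1).
  by rewrite -winding_loop_class; congr (winding_class (H1_push P1 _));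
    exact: orbit_loop_classE (fcs_card_gt0 Gamma1) h1K h1'K h1E.
have o2 : winding_class (H1_push P2 (orbit_loop_class (torus_incl k Gamma2 \o sigma2))) =
    degree (P2 \o c2).
  by rewrite -winding_loop_class; congr (winding_class (H1_push P2 _));
    exact: orbit_loop_classE (fcs_card_gt0 Gamma2) h2K h2'K h2E.
have w1 := winding_fiber_one P1E; have w2 := winding_fiber_one P2E.
(* Here r = e_1 / e_2 is the power by which the quotient map G acts on angular coordinates. *)
have /dvdnP[r re] := pow_order_dvd k Gamma21.
have P12 u : P1 (orbit_quo (solid_torus_action R k) Gamma21 u) = (P2 u ^+ r)%g.
  rewrite -[u]orbit_reprK; move: (orbit_repr u) => -[z x].
  have e1 := etrans (congr1 P1 (orbit_quoE (solid_torus_action R k) Gamma21 (z, x))) (P1E z x).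
  have e2 := congr1 (fun t => t ^+ r)%g (P2E z x).
  apply: etrans e1 (etrans _ (esym e2)).
  by rewrite re mulnC expgnA.
(* The map f is computed in two ways. In the coordinates [h1] and [h2] the base map g is the power
   [Gamma_1 : Gamma_2], because n_1 = [Gamma_1 : Gamma_2] n_2; compatibility of the sections then
   gives f(y) = P2(c2(y))^r. *)
have deg : (subgroup_index Gamma1 Gamma2)%:R * degree (P1 \o c1) = degree (P2 \o c2) * r%:R.
  rewrite -!(degree_pow R).
  pose f : continuousType (circle R) (circle R) :=
    (P1 \o c1) \o circle_pow R (subgroup_index Gamma1 Gamma2).
  rewrite -(@degree_comp R (circle_pow R (subgroup_index Gamma1 Gamma2)) (P1 \o c1) f)//.
  rewrite -(@degree_comp R (P2 \o c2) (circle_pow R r) f)// => y.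
  have [x <-] := circle_root y (fcs_card_gt0 Gamma2).
  set w := (x ^+ _)%g.
  have e2 : h2' w = orbit_pi Gamma2 (rot_action R) x.
    exact: etrans (congr1 h2' (esym (h2E x))) (h2K _).
  have e1 : h1' (w ^+ subgroup_index Gamma1 Gamma2)%g = orbit_pi Gamma1 (rot_action R) x.
    rewrite /w -expgnA mulnC -(subgroup_indexM Gamma21).
    exact: etrans (congr1 h1' (esym (h1E x))) (h1K _).
  have q12 := orbit_quoE (rot_action R) Gamma21 x.
  have c2E := congr1 (fun t => (P2 (torus_incl k Gamma2 (sigma2 t)) ^+ r)%g) e2.
  have c1E := congr1 (fun t => P1 (torus_incl k Gamma1 (sigma1 t))) (etrans e1 (esym q12)).
  apply: etrans c2E (etrans _ (esym c1E)).
  exact: etrans (esym (P12 _)) (congr1 P1 (sigma12 _)).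
have r0 : r%:R != 0 :> rat.
  by rewrite pnatr_eq0; apply: contraTneq (pow_order_gt0 Gamma1 k) => r0; rewrite re r0.
have t12 : (subgroup_index Gamma1 Gamma2)%:R *
    winding_class (H1_push P1 (orbit_loop_class (torus_incl k Gamma1 \o sigma1))) =
    winding_class (H1_push P2 (orbit_loop_class (torus_incl k Gamma2 \o sigma2))) * r%:R.
  exact: etrans (congr1 _ o1) (etrans deg (congr1 (fun t => t * r%:R) (esym o2))).
have s12 : winding_class (H1_push P1 (loop_class (fiber_one k Gamma1))) =
    r%:R * winding_class (H1_push P2 (loop_class (fiber_one k Gamma2))).
  apply: etrans w1 (etrans _ (congr1 _ (esym w2))).
  by rewrite re natrM.
exact: angular_transfer P1A P2A r0 t12 s12.
Qed.
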